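(* Let $K$ be a knot type in $\mathbb{R}^3$, let $m_K\le\Lambda<\infty$ and let $x,y\in Y_\Lambda(K)$. If $x$ and $y$ lie in the same connected component of $Y_{\Lambda+\varepsilon}(K)$ for every $\varepsilon>0$, then they lie in the same connected component of $Y_\Lambda(K)$. Equivalently, the map $$\operatorname{Conn}\bigl(Y_\Lambda(K)\bigr)\longrightarrow\varprojlim_{\varepsilon>0}\ \operatorname{im}\bigl[\operatorname{Conn}(Y_\Lambda(K))\to\operatorname{Conn}(Y_{\Lambda+\varepsilon}(K))\bigr]$$ induced by the inclusions is injective.
   Context: $\operatorname{Conn}(X)$ denotes the set of connected components (not path components) of a space $X$. Knot types are tame types of knots (one component) in Euclidean $\mathbb{R}^3$. For an embedded closed $C^{1,1}$ curve $\gamma$ ($C^1$ with Lipschitz unit tangent), $\operatorname{Len}(\gamma)$ is the length and the thickness $\operatorname{Thi}(\gamma)$ is the reach of its image, i.e. the supremum of $r>0$ for which the closed $r$-neighbourhood is an embedded solid torus that is the union of the closed normal discs of radius $r$; equivalently, $\operatorname{Thi}(\gamma)$ is the infimum of the radii of circles through three distinct points of $\gamma$. The minimal ropelength is $m_K=\inf\{\operatorname{Len}(\gamma)/\operatorname{Thi}(\gamma):[\gamma]=K\}$. Represent configurations by constant-speed $C^{1,1}$ embeddings $\gamma:S^1=\mathbb{R}/2\pi\mathbb{Z}\to\mathbb{R}^3$, and identify two of them when they differ by an orientation-preserving Euclidean isometry and a rotation or reflection of the source circle. For $m_K\le\Lambda<\infty$, $$Y_\Lambda(K)=\{[\gamma]:\gamma\text{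 has knot type }K,\ \operatorname{Thi}(\gamma)\ge1,\ \operatorname{Len}(\gamma)\le\Lambda\},$$ topologised as a quotient of the constant-speed $C^1$ topology. *)

(* Defs.v *)
From HB Require Import structures.
From mathcomp Require Import all_boot all_order all_algebra.
From mathcomp Require Import generic_quotient.
From mathcomp Require Import all_classical all_reals all_analysis.

Set Implicit Arguments.
Unset Strict Implicit.
Unset Printing Implicit Defensive.

Import Order.TTheory GRing.Theory Num.Theory.
Import numFieldNormedType.Exports.

Local Open Scope classical_set_scope.
Local Open Scope ring_scope.
Local Open Scope quotient_scope.

(* The library's norm on 'rV[R]_3 is the sup norm: it is used for topology (and
   Lipschitz continuity) only.  Lengths and distances are Euclidean. *)
Definition enorm (R : realType) (v : 'rV[R]_3) : R :=
  Num.sqrt (\sum_(i < 3) v 0 i ^+ 2).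

Section knot_types.
Context {R : realType}.
Implicit Types A B : set 'rV[R]_3.

(* Maps out of S^1 = R/2piZ are represented by 2pi-periodic maps out of R. *)
Definition periodic2pi (T : Type) (f : R -> T) :=
  forall t, f (t + 2 * pi) = f t.

Definition injective_mod2pi (T : Type) (f : R -> T) :=
  forall s t, f s = f t -> exists k : int, s = t + k%:~R * (2 * pi).

Definition knot A :=
  exists f : R -> 'rV[R]_3,
    [/\ continuous f, periodic2pi f, injective_mod2pi f & A = range f].

Definition segment (a b : 'rV[R]_3) : set 'rV[R]_3 :=
  [set (1 - t) *: a + t *: b | t in `[0, 1]].

Definition polygonal_knot A :=
  knot A /\ exists s : seq ('rV[R]_3 * 'rV[R]_3),
    A = \bigcup_(ab in [set` s]) segment ab.1 ab.2.

Definition homeomorphism (h : 'rV[R]_3 -> 'rV[R]_3) :=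
  continuous h /\ exists g, [/\ continuous g, cancel h g & cancel g h].

Definition ambient_isotopic A B :=
  exists H : R * 'rV[R]_3 -> 'rV[R]_3,
    [/\ {within `[0, 1] `*` [set: 'rV[R]_3], continuous H},
        forall s, 0 <= s <= 1 -> homeomorphism (fun x => H (s, x)),
        forall x, H (0, x) = x
      & (fun x => H (1, x)) @` A = B].

Definition tame_knot A :=
  knot A /\ exists B, polygonal_knot B /\ ambient_isotopic A B.

(* Knot types are unoriented: ambient isotopy classes of images of knots. *)
Definition knot_type (K : set (set 'rV[R]_3)) :=
  exists A, tame_knot A /\ K = [set B | ambient_isotopic A B].

(* Federer's reach. *)
Definition reach A : \bar R :=
  ereal_sup [set r%:E | r in [set r : R | 0 <= r /\
    forall x, (exists2 a, A a & enorm (x - a) < r) ->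
      exists! a, A a /\ forall b, A b -> enorm (x - a) <= enorm (x - b)]].

End knot_types.

(* Constant speed makes Lipschitz continuity of the derivative and of the unit
   tangent the same; the speed is nonzero by injectivity. *)
Definition C11_embedding (R : realType) (f : R -> 'rV[R]_3) :=
  [/\ periodic2pi f,
      injective_mod2pi f,
      (forall t, derivable f t 1),
      [lipschitz (f^`()%classic t) | t in [set: R]]
    & exists c, forall t, enorm (f^`()%classic t) = c].

Record curve (R : realType) := Curve {
  curve_fun :> R -> 'rV[R]_3 ;
  curveP : C11_embedding curve_fun }.

HB.instance Definition _ (R : realType) := gen_eqMixin (curve R).
HB.instance Definition _ (R : realType) := gen_choiceMixin (curve R).

Definition jet (R : realType) (g : curve R) :
    {uniform R -> 'rV[R]_3} * {uniform R -> 'rV[R]_3} :=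
  (g : R -> 'rV[R]_3, g^`()%classic).

(* The C^1 topology. *)
HB.instance Definition _ (R : realType) :=
  Topological.copy (curve R) (initial_topology (@jet R)).

Section moduli.
Context {R : realType}.
Implicit Types g h : curve R.

Definition length g : R :=
  (\int[lebesgue_measure]_(t in `[0%R, (2 * pi)%R]) enorm (g^`()%classic t))%R.

Definition thickness g : \bar R := reach (range g).

Definition min_ropelength (K : set (set 'rV[R]_3)) : \bar R :=
  ereal_inf [set ((length g)%:E / thickness g)%E |
             g in [set g : curve R | K (range g)]].

Definition congruent g h :=
  exists (Q : 'M[R]_3) (b : 'rV[R]_3) (a s : R),
    [/\ Q *m Q^T = 1%:M, \det Q = 1, s = 1 \/ s = -1
      & forall t, h t = g (s * t + a) *m Q + b].

Lemma congruent_refl g : congruent g g.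
Proof.
exists 1%:M, 0, 0, 1; split; [|exact: det1|by left|].
  by rewrite trmx1 mulmx1.
by move=> t; rewrite mul1r !addr0 mulmx1.
Qed.

Lemma congruent_sym g h : congruent g h -> congruent h g.
Proof.
move=> [Q [b [a [s [QQ dQ hs E]]]]].
have ss : s * s = 1 by case: hs => ->; rewrite ?mulr1// mulrNN mulr1.
exists Q^T, (- (b *m Q^T)), (- (s * a)), s; split => //.
- by rewrite trmxK; exact: mulmx1C.
- by rewrite det_tr.
move=> t; rewrite E mulmxDl -mulmxA QQ mulmx1 addrK.
by rewrite mulrDr mulrN !mulrA ss !mul1r subrK.
Qed.

Lemma congruent_trans g h k : congruent g h -> congruent h k -> congruent g k.
Proof.
move=> [Q [b [a [s [QQ dQ hs E]]]]] [Q' [b' [a' [s' [QQ' dQ' hs' E']]]]].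
exists (Q *m Q'), (b *m Q' + b'), (s * a' + a), (s * s'); split.
- by rewrite trmx_mul mulmxA -(mulmxA Q) QQ' mulmx1.
- by rewrite det_mulmx dQ dQ' mulr1.
- by case: hs => ->; case: hs' => ->; rewrite ?mulrNN ?mulr1 ?mul1r; auto.
- by move=> t; rewrite E' E mulmxDl addrA mulmxA mulrDr mulrA addrA.
Qed.

Definition congruentb : rel (curve R) := fun g h => `[< congruent g h >].

Lemma congruentb_refl : reflexive congruentb.
Proof. by move=> g; apply/asboolP; exact: congruent_refl. Qed.

Lemma congruentb_sym : symmetric congruentb.
Proof. by move=> g h; apply/asbool_equiv_eq; split; exact: congruent_sym. Qed.

Lemma congruentb_trans : transitive congruentb.
Proof.
by move=> h g k /asboolP gh /asboolP hk; apply/asboolP; exact: congruent_trans hk.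
Qed.

Canonical congruentb_equiv :=
  EquivRel congruentb congruentb_refl congruentb_sym congruentb_trans.

(* The configurations up to congruence, with the quotient of the C^1 topology. *)
Definition moduli : topologicalType :=
  quotient_topology {eq_quot congruentb_equiv}.

(* Its topology is the subspace topology of moduli.  This is the quotient of the
   C^1 topology on the curves representing its points, because the fibres of the
   projection are the orbits of a group of homeomorphisms. *)
Definition Y (K : set (set 'rV[R]_3)) (Lambda : R) : set moduli :=
  [set \pi_moduli g | g in [set g : curve R |
    [/\ K (range g), (1 <= thickness g)%E & length g <= Lambda]]].

End moduli.

Section components.
Context {T : topologicalType}.
Implicit Types A C : set T.

Definition Conn A : set (set T) := connected_component A @` A.

(* For C a component of a subset of A, this is the component of A containing C. *)
Definition Conn_incl A C : set T := \bigcup_(x in C) connected_component A x.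

Context {R : realType}.
Implicit Type B : {posnum R} -> set T.

(* The inverse limit, over e > 0, of im [Conn A -> Conn (B e)]. *)
Definition Conn_lim A B : set ({posnum R} -> set T) :=
  [set c | (forall e, (Conn_incl (B e) @` Conn A) (c e)) /\
           forall d e : {posnum R},
             d%:num <= e%:num -> Conn_incl (B e) (c d) = c e].

Definition Conn_to_lim B C : {posnum R} -> set T :=
  fun e => Conn_incl (B e) C.

End components.

(* Main.v *)
(** A closed curve of constant speed has reach at least 1 if and only if no
    open unit ball tangent to it meets it; the non-trivial implication is
    Federer's, by maximising the distance to the curve over small balls.  Since
    the chord and the velocity enter this condition polynomially, it is closed
    for pointwise convergence of curves and of their derivatives, and it bounds
    the Lipschitz constant of the derivative and the ratio of arc to chord.

    Consequently the thick curves of bounded length starting at the origin form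
    a compact set for the C^1 topology, and any curve C^1-close to a thick curve
    is the image of it under a perturbation of the identity with small Lipschitz
    constant, hence ambient isotopic to it.  So the spaces [Y K L] are compact
    and closed in the moduli space, which is normal because congruences are
    isometries of the C^1 distance.  In a normal space the intersection of a
    decreasing family of compact components is connected; for the components
    of [x] in [Y K (Lambda + e)], this intersection lies in [Y K Lambda] and
    contains [y]. *)
Require Import Defs.
From HB Require Import structures.
From mathcomp Require Import all_boot all_order all_algebra.
From mathcomp Require Import generic_quotient.
From mathcomp Require Import all_classical all_reals all_analysis.
From mathcomp Require Import ring lra.

Set Implicit Arguments.
Unset Strict Implicit.
Unset Printing Implicit Defensive.

Import Order.TTheory GRing.Theory Num.Theory.
Import numFieldNormedType.Exports.

Local Open Scope classical_set_scope.
Local Open Scope ring_scope.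

(** * Components of decreasing intersections *)

Section component_intersection.
Context {R : realType} {T : topologicalType}.
Variable Z : R -> set T.
Hypothesis normalT : normal_space T.
Hypothesis closedZ : forall e, 0 < e -> closed (Z e).
Hypothesis compactZ : forall e, 0 < e -> compact (Z e).
Hypothesis subZ : forall d e, d <= e -> Z d `<=` Z e.

(** A separation of the intersection would consist of two disjoint closed sets, which normality puts
    into disjoint open sets [U] and [V]. Each component contains the intersection, so it meets both
    and, being connected, leaves their union; compactness then gives a point of the intersection
    outside [U] and [V]. *)
Lemma connected_bigcap_component x :
  connected (\bigcap_(e in [set e : R | 0 < e]) connected_component (Z e) x).
Proof.
set D := \bigcap_(_ in _) _.
have closedC e : 0 < e -> closed (connected_component (Z e) x).
  by move=> e0; apply: component_closed; exact: closedZ.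
have closedD : closed D by apply: closed_bigI => e /closedC.
apply/connectedP => E [E0 DE [sE1 sE2]].
have subED b : E b `<=` D by rewrite DE; case: b; [exact: subsetUr|exact: subsetUl].
have closE b : closure (E b) `<=` D.
  by move=> p Ep; rewrite (closure_id D).1//; exact: closureS Ep.
have cl0 : closed (E false).
  rewrite closure_id eqEsubset; split; first exact: subset_closure.
  move=> p Ep; have := closE _ _ Ep; rewrite DE => -[//|Etp].
  by have : set0 p by rewrite -sE1.
have cl1 : closed (E true).
  rewrite closure_id eqEsubset; split; first exact: subset_closure.
  move=> p Ep; have := closE _ _ Ep; rewrite DE => -[Etp|//].
  by have : set0 p by rewrite -sE2.
have E01 : E false `&` E true = set0 by exact: separated_disjoint.
have [U [V [oU oV EU EV UV0]]] := (@normal_openP R T).1 normalT _ _ cl0 cl1 E01.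
have sUV : separated U V.
  split; apply/disjoints_subset => p.
    by move=> cU Vp; have [q UVq] := cU V (open_nbhs_nbhs (conj oV Vp)); move: UVq; rewrite UV0.
  move=> Up cV; have [q UVq] := cV U (open_nbhs_nbhs (conj oU Up)).
  by move: UVq; rewrite setIC UV0.
have nonempty e : 0 < e -> (connected_component (Z e) x `\` (U `|` V)) !=set0.
  move=> e0; apply/set0P/negP => /eqP; rewrite setD_eq0 => CUV.
  have [CU|CV] := connected_subset sUV CUV (component_connected (A := Z e) (x:=x)).
  - have [p Ep] := E0 true.
    have : set0 p by rewrite -UV0; split; [apply/CU/(subED _ _ Ep)|exact: EV].
    by [].
  - have [p Ep] := E0 false.
    have : set0 p by rewrite -UV0; split; [exact: EU|apply/CV/(subED _ _ Ep)].
    by [].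
(* The remainders outside [U] and [V] shrink with [e], hence generate a proper filter on the compact
   set [Z 1]; being closed, they all contain its cluster points. *)
pose G := filter_from [set e : R | 0 < e]
  (fun e => connected_component (Z e) x `\` (U `|` V)).
have mono d e : d <= e ->
    connected_component (Z d) x `<=` connected_component (Z e) x.
  move=> de p [C [Cx CZ cC] Cp]; exists C => //; split=> //.
  exact: subset_trans (subZ de).
have FG : ProperFilter G.
  apply: filter_from_proper => //; apply: filter_from_filter; first by exists 1 => /=.
  move=> d e /= d0 e0; exists (Num.min d e); first by rewrite /= lt_min d0.
  move=> p [Cp nUV]; split; split => //; apply: mono Cp.
  - by rewrite ge_min lexx.
  - by rewrite ge_min lexx orbT.
have GZ : G (Z 1).
  exists 1 => /=; first exact: ltr01.
  by move=> p [Cp _]; exact: connected_component_sub Cp.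
have [p [Zp]] := compactZ ltr01 FG GZ.
rewrite clusterE => clp.
have Fp e : 0 < e -> (connected_component (Z e) x `\` (U `|` V)) p.
  move=> e0; have cF : closed (connected_component (Z e) x `\` (U `|` V)).
    apply: closedI; first exact: closedC.
    by apply: open_closedC; exact: openU.
  by move/closure_id : cF => ->; apply: clp; exists e.
have : D p by move=> e /Fp [].
have [_ nUV] := Fp _ ltr01.
by rewrite DE => -[/EU Up|/EV Vp]; apply: nUV; [left|right].
Qed.

Lemma connected_component_bigcap A x y :
  A = \bigcap_(e in [set e : R | 0 < e]) Z e -> A x -> A y ->
  (forall e, 0 < e ->
     connected_component (Z e) x = connected_component (Z e) y) ->
  connected_component A x = connected_component A y.
Proof.
move=> AE Ax Ay xy; apply: same_connected_component.
exists (\bigcap_(e in [set e : R | 0 < e]) connected_component (Z e) x).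
  split; last exact: connected_bigcap_component.
  - move=> e /= e0; apply: connected_component_refl.
    by move: Ax; rewrite AE; exact.
  - by rewrite AE => p Cp e e0; apply: connected_component_sub (Cp e e0).
move=> e /= e0; rewrite xy//; apply: connected_component_refl.
by move: Ay; rewrite AE; exact.
Qed.

End component_intersection.

(** * Component systems and the map to their inverse limit *)

Section component_systems.
Context {T : topologicalType} {R : realType}.
Variables (A : set T) (B : {posnum R} -> set T).
Hypothesis subAB : forall e, A `<=` B e.
Hypothesis subBB : forall d e : {posnum R}, d%:num <= e%:num -> B d `<=` B e.

(** Evaluates the maps of the inverse system on the component of a chosen representative. *)
Lemma Conn_incl_component (C D : set T) x : C `<=` D -> C x ->
  Conn_incl D (connected_component C x) = connected_component D x.
Proof.
move=> CD Cx; have sub : connected_component C x `<=` connected_component D x.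
  move=> p [E [Ex EC cE] Ep]; exists E => //; split=> //.
  exact: subset_trans CD.
apply/seteqP; split=> p.
  by move=> [q /sub xq qp]; exact: connected_component_trans qp.
by move=> xp; exists x => //; exact: connected_component_refl.
Qed.

Lemma set_fun_Conn_to_lim : set_fun (Conn A) (Conn_lim A B) (Conn_to_lim B).
Proof.
move=> _ [x Ax <-]; split=> [e|d e de]; rewrite /Conn_to_lim.
  by exists (connected_component A x) => //; exists x.
by rewrite !Conn_incl_component//; [exact: subBB|exact: subAB].
Qed.

Lemma set_inj_Conn_to_lim :
  (forall x y, A x -> A y ->
     (forall e, connected_component (B e) x = connected_component (B e) y) ->
     connected_component A x = connected_component A y) ->
  set_inj (Conn A) (Conn_to_lim B).
Proof.
move=> inj _ _ /set_mem[x Ax <-] /set_mem[y Ay <-] E; apply: inj => // e.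
by have := congr1 (fun c => c e) E; rewrite /Conn_to_lim !Conn_incl_component.
Qed.

End component_systems.

(** * Euclidean geometry *)

Section euclidean_space.
Context {R : realType}.
Implicit Types (u v w : 'rV[R]_3) (a b : R).

Definition dot u v : R := \sum_(i < 3) u 0 i * v 0 i.

Lemma dotC u v : dot u v = dot v u.
Proof. by apply: eq_bigr => i _; rewrite mulrC. Qed.

Lemma dotDl u v w : dot (u + v) w = dot u w + dot v w.
Proof. by rewrite -big_split; apply: eq_bigr => i _; rewrite mxE mulrDl. Qed.

Lemma dotZl a u v : dot (a *: u) v = a * dot u v.
Proof. by rewrite mulr_sumr; apply: eq_bigr => i _; rewrite mxE mulrA. Qed.

Lemma dotDr u v w : dot u (v + w) = dot u v + dot u w.
Proof. by rewrite dotC dotDl !(dotC u). Qed.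

Lemma dotZr a u v : dot u (a *: v) = a * dot u v.
Proof. by rewrite dotC dotZl dotC. Qed.

Lemma dotNl u v : dot (- u) v = - dot u v.
Proof. by rewrite -scaleN1r dotZl mulN1r. Qed.

Lemma dotNr u v : dot u (- v) = - dot u v.
Proof. by rewrite dotC dotNl dotC. Qed.

Lemma dotBl u v w : dot (u - v) w = dot u w - dot v w.
Proof. by rewrite dotDl dotNl. Qed.

Lemma dotBr u v w : dot u (v - w) = dot u v - dot u w.
Proof. by rewrite dotDr dotNr. Qed.

Lemma dot0l v : dot 0 v = 0.
Proof. by rewrite -(subrr v) dotBl subrr. Qed.

Definition dotE := (dotDl, dotDr, dotNl, dotNr, dotZl, dotZr).

Lemma dot_ge0 v : 0 <= dot v v.
Proof. by apply: sumr_ge0 => i _; rewrite -expr2 sqr_ge0. Qed.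

Lemma dot_eq0 v : (dot v v == 0) = (v == 0).
Proof.
apply/eqP/eqP => [/eqP|->]; last by rewrite -(scale0r 0) dotZl mul0r.
rewrite psumr_eq0 => [/allP v0|i _]; last by rewrite -expr2 sqr_ge0.
apply/rowP => i; rewrite mxE; apply/eqP.
by have := v0 i (mem_index_enum _); rewrite mulf_eq0 orbb.
Qed.

Lemma dot_gt0 v : (0 < dot v v) = (v != 0).
Proof. by rewrite lt_def dot_ge0 andbT dot_eq0. Qed.

Lemma enormE v : enorm v = Num.sqrt (dot v v).
Proof. by congr Num.sqrt; apply: eq_bigr => i _; rewrite expr2. Qed.

Lemma enorm_ge0 v : 0 <= enorm v.
Proof. exact: sqrtr_ge0. Qed.

Lemma sqr_enorm v : enorm v ^+ 2 = dot v v.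
Proof. by rewrite enormE sqr_sqrtr ?dot_ge0. Qed.

Lemma enorm_eq0 v : (enorm v == 0) = (v == 0).
Proof. by rewrite -dot_eq0 -sqr_enorm expf_eq0. Qed.

Lemma enorm_gt0 v : (0 < enorm v) = (v != 0).
Proof. by rewrite lt_def enorm_ge0 andbT enorm_eq0. Qed.

Lemma enorm0 : enorm (0 : 'rV[R]_3) = 0.
Proof. by apply/eqP; rewrite enorm_eq0. Qed.

Lemma enorm_le_sqr v a : 0 <= a -> (enorm v <= a) = (dot v v <= a ^+ 2).
Proof. by move=> a0; rewrite -sqr_enorm ler_pXn2r// nnegrE ?enorm_ge0. Qed.

Lemma ler_enorm u v : (enorm u <= enorm v) = (dot u u <= dot v v).
Proof. by rewrite enorm_le_sqr ?enorm_ge0// sqr_enorm. Qed.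

Lemma enormZ a v : enorm (a *: v) = `|a| * enorm v.
Proof.
by rewrite !enormE dotZl dotZr mulrA -expr2 sqrtrM ?sqr_ge0// sqrtr_sqr.
Qed.

Lemma enormN v : enorm (- v) = enorm v.
Proof. by rewrite -scaleN1r enormZ normrN1 mul1r. Qed.

Lemma enormC u v : enorm (u - v) = enorm (v - u).
Proof. by rewrite -opprB enormN. Qed.

Lemma cauchy_schwarz_sqr u v : dot u v ^+ 2 <= dot u u * dot v v.
Proof.
have [->|v0] := eqVneq v 0.
  by rewrite -(scale0r 0) !(dotZl, dotZr) !mul0r mulr0 expr0n.
(* Up to the factor [dot v v], this vector is the part of [u] normal to [v]; its squared length
   expands to [dot v v] times the difference of the two sides. *)
have := dot_ge0 (dot v v *: u - dot u v *: v).
rewrite !dotE (dotC v u) => H; have vv : 0 < dot v v by rewrite dot_gt0.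
by rewrite -(ler_pM2l vv) -subr_ge0 (le_trans H)// le_eqVlt; apply/orP; left; apply/eqP; ring.
Qed.

Lemma norm_dot u v : `|dot u v| <= enorm u * enorm v.
Proof.
rewrite -[leLHS]ger0_norm// -ler_sqr ?nnegrE ?mulr_ge0 ?enorm_ge0//.
by rewrite normr_id exprMn !sqr_enorm real_normK ?num_real ?cauchy_schwarz_sqr.
Qed.

Lemma dot_le u v : dot u v <= enorm u * enorm v.
Proof. exact: le_trans (ler_norm _) (norm_dot u v). Qed.

Lemma enormD u v : enorm (u + v) <= enorm u + enorm v.
Proof.
rewrite enorm_le_sqr ?addr_ge0 ?enorm_ge0// sqrrD !sqr_enorm !dotE (dotC v u).
by have := dot_le u v; lra.
Qed.

Lemma enorm_triangle v u w : enorm (u - w) <= enorm (u - v) + enorm (v - w).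
Proof. by rewrite (le_trans _ (enormD _ _))// addrA subrK. Qed.

Lemma norm_le_enorm v : `|v| <= enorm v.
Proof.
rewrite [leLHS]/Num.Def.normr/= mx_normrE; apply/bigmax_leP => /=.
split=> [|[i j] _ /=]; first exact: enorm_ge0.
rewrite (ord1 i) -(ler_pXn2r (n := 2))// ?nnegrE ?enorm_ge0//.
rewrite sqr_enorm real_normK ?num_real// /dot (bigD1 j)//= -expr2 lerDl.
by apply: sumr_ge0 => k _; rewrite -expr2 sqr_ge0.
Qed.

(** The optimal factor is the square root of 3; the integer 2 keeps later constants simple. *)
Lemma enorm_le_norm v : enorm v <= 2 * `|v|.
Proof.
rewrite enorm_le_sqr ?mulr_ge0//.
have coord i : v 0 i * v 0 i <= `|v| ^+ 2.
  rewrite -expr2 -[leLHS]real_normK ?num_real//.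
  rewrite ler_pXn2r ?nnegrE// [leRHS]/Num.Def.normr/= mx_normrE.
  exact: (le_bigmax _ (fun ij => `|v ij.1 ij.2|) (0, i)).
have := sqr_ge0 `|v|.
rewrite /dot !big_ord_recl big_ord0 addr0.
have := coord ord0; have := coord (lift ord0 ord0).
by have := coord (lift ord0 (lift ord0 ord0)); lra.
Qed.

Lemma dot_mulmx (Q : 'M[R]_3) u v : Q *m Q^T = 1%:M ->
  dot (u *m Q) (v *m Q) = dot u v.
Proof.
have dotM x y : dot x y = (x *m y^T) 0 0.
  by rewrite mxE; apply: eq_bigr => i _; rewrite mxE.
by move=> QQ; rewrite !dotM trmx_mul mulmxA -(mulmxA u) QQ mulmx1.
Qed.

Lemma enorm_mulmx (Q : 'M[R]_3) v : Q *m Q^T = 1%:M ->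
  enorm (v *m Q) = enorm v.
Proof. by move=> QQ; rewrite !enormE dot_mulmx. Qed.

End euclidean_space.

(** * Mean value and Taylor estimates for space curves *)

Section space_curves.
Context {R : realType}.
Variables g dg : R -> 'rV[R]_3.
Hypothesis gdg : forall t, is_derive t (1:R) g (dg t).

Lemma is_derive_dot n t : is_derive t (1:R) (fun s => dot (g s) n) (dot (dg t) n).
Proof.
have [dgt Dgt] := gdg t.
have coord i : is_derive t (1:R) (fun s => g s 0 i) (dg t 0 i).
  split; first exact: (derivable_mxP _ _ _).1 dgt 0 i.
  by rewrite -Dgt derive_mx// mxE.
have -> : (fun s => dot (g s) n) = \sum_(i < 3) (fun s => n 0 i *: g s 0 i).
  by apply/funext => s; rewrite fct_sumE; apply: eq_bigr => i _; rewrite mulrC.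
have := @is_derive_sum _ _ _ 3 (fun i s => n 0 i *: g s 0 i) t 1 _ (fun i => is_deriveZ (n 0 i) (coord i)).
move=> H; apply: is_derive_eq H _.
by apply: eq_bigr => i _; rewrite mulrC.
Qed.

Lemma is_derive_sqdist p t :
  is_derive t (1:R) (fun s => dot (g s - p) (g s - p)) (2 * dot (dg t) (g t - p)).
Proof.
have [dgt Dgt] := gdg t.
have coord i : is_derive t (1:R) (fun s => g s 0 i) (dg t 0 i).
  split; first exact: (derivable_mxP _ _ _).1 dgt 0 i.
  by rewrite -Dgt derive_mx// mxE.
have -> : (fun s => dot (g s - p) (g s - p)) =
    \sum_(i < 3) (((fun s => g s 0 i) - cst (p 0 i)) ^+ 2 : R -> R).
  by apply/funext => s; rewrite fct_sumE; apply: eq_bigr => i _; rewrite !mxE expr2.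
have coordB i : is_derive t (1:R) ((fun s => g s 0 i) - cst (p 0 i)) (dg t 0 i).
  by rewrite -[X in is_derive _ _ _ X]subr0; exact: is_deriveB.
have := @is_derive_sum _ _ _ 3 _ t 1 _ (fun i => is_deriveX 2 (coordB i)).
move=> H; apply: is_derive_eq H _.
rewrite mulr_sumr; apply: eq_bigr => i _.
by rewrite expr1 !mxE /= [_ *: _]mulrC mulrCA mulrA.
Qed.

Lemma dot_critical p a b t : a < t < b ->
  (forall s, a < s < b -> dot (g t - p) (g t - p) <= dot (g s - p) (g s - p)) ->
  dot (dg t) (g t - p) = 0.
Proof.
move=> atb H; have /andP[a_t t_b] := atb.
have [] := @derive1_at_min R (fun s => dot (g s - p) (g s - p)) a b t.
- by rewrite ltW// (lt_trans a_t).
- by move=> s _; case: (is_derive_sqdist p s).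
- by rewrite in_itv.
- by move=> s; rewrite in_itv; exact: H.
by move=> _; have [_ ->] := is_derive_sqdist p t => /eqP; rewrite mulf_eq0 pnatr_eq0 => /eqP.
Qed.

(** The mean value theorem holds for scalar components only. In the norm estimates [n] is the very
    vector to be bounded. *)
Lemma dot_mvt n a b : a < b ->
  exists c, a < c < b /\ dot (g b) n - dot (g a) n = dot (dg c) n * (b - a).
Proof.
move=> ab; have [||c cab ->] := MVT ab (f := fun s => dot (g s) n)
  (df := fun s => dot (dg s) n).
- by move=> s _; exact: is_derive_dot.
- by apply: derivable_within_continuous => s _; case: (is_derive_dot n s).
- by exists c; split=> //; move: cab; rewrite in_itv.
Qed.

Lemma continuous_curve : continuous g.
Proof.
move=> t; apply: differentiable_continuous; apply/derivable1_diffP.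
by case: (gdg t).
Qed.

Lemma enorm_chord k a b : (forall c, enorm (dg c) <= k) ->
  enorm (g b - g a) <= k * `|b - a|.
Proof.
move=> dgk; wlog ab : a b / a < b.
  move=> H; have [ab|ba|->] := ltgtP a b; first exact: H.
    by rewrite enormC distrC; exact: H.
  by rewrite !subrr enorm0 normr0 mulr0.
have [c [_ E]] := dot_mvt (g b - g a) ab.
have [->|w0] := eqVneq (g b - g a) 0.
  by rewrite enorm0 mulr_ge0// (le_trans (enorm_ge0 (dg a))).
have w1 : 0 < enorm (g b - g a) by rewrite enorm_gt0.
rewrite gtr0_norm ?subr_gt0// -(ler_pM2r w1) -expr2 sqr_enorm dotBl E.
rewrite mulrAC ler_pM2r ?subr_gt0//; apply: le_trans (dot_le _ _) _.
by rewrite ler_pM2r.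
Qed.

(** Mean value theorem along the remainder [w], then Cauchy-Schwarz. The factor 1/2 of the integral
    form is given up. *)
Lemma taylor1 C s t : (forall c d, enorm (dg c - dg d) <= C * `|c - d|) ->
  enorm (g s - g t - (s - t) *: dg t) <= C * (s - t) ^+ 2.
Proof.
move=> dgC; have [w wE] : exists w, w = g s - g t - (s - t) *: dg t by eexists.
rewrite -wE.
have C0 : 0 <= C.
  by have := dgC 1 0; rewrite subr0 normr1 mulr1; apply: le_trans; exact: enorm_ge0.
have [c cst E] : exists2 c, `|c - t| <= `|s - t| &
    dot (g s) w - dot (g t) w = dot (dg c) w * (s - t).
  have [st|ts|->] := ltgtP s t.
  - have [c [/andP[sc ct] E]] := dot_mvt w st; exists c; last lra.
    by rewrite !ltr0_norm ?subr_lt0// lerN2 lerB// ltW.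
  - have [c [/andP[sc ct] E]] := dot_mvt w ts; exists c => //.
    by rewrite !gtr0_norm ?subr_gt0// lerB// ltW.
  - by exists t => //; rewrite !subrr mulr0.
have [->|w0] := eqVneq w 0; first by rewrite enorm0 mulr_ge0 ?sqr_ge0.
have w1 : 0 < enorm w by rewrite enorm_gt0.
rewrite -(ler_pM2r w1) -expr2 sqr_enorm {1}wE !(dotBl, dotZl) E.
rewrite [X in X <= _](_ : _ = (s - t) * dot (dg c - dg t) w); last by rewrite !dotE; lra.
apply: le_trans (ler_norm _) _; rewrite normrM -(real_normK (num_real (s - t))).
apply: le_trans (ler_wpM2l (normr_ge0 _) (norm_dot _ _)) _.
rewrite mulrA ler_pM2r// expr2 mulrA mulrC ler_wpM2r//.
by apply: le_trans (dgC _ _) _; rewrite ler_wpM2l.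
Qed.

End space_curves.

(** A quadratic remainder bound survives pointwise limits and rigid motions, so this criterion
    differentiates limits of curves and moved curves. *)
Lemma is_derive_taylor (R : realType) (g : R -> 'rV[R]_3) v t C :
  (forall s, enorm (g s - g t - (s - t) *: v) <= C * (s - t) ^+ 2) ->
  is_derive t (1:R) g v.
Proof.
move=> gC.
have C0 : 0 <= C.
  have E : (t + 1 - t) ^+ 2 = 1 by ring.
  have := gC (t + 1); rewrite E mulr1.
  by apply: le_trans; exact: enorm_ge0.
suff lim : h^-1 *: (g (h *: 1 + t) - g t) @[h --> (0:R)^'] --> v.
  by split; [apply/cvg_ex; exists v|exact/cvg_lim].
apply/cvgrPdist_le => /= e e0; near=> h.
have h0 : h != 0 by near: h; exact: nbhs_dnbhs_neq.
have -> : v - h^-1 *: (g (h *: 1 + t) - g t) =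
    - h^-1 *: (g (h *: 1 + t) - g t - (h *: 1 + t - t) *: v).
  by rewrite addrK [h *: 1]mulr1 [RHS]scalerBr scalerA mulNr mulVf// !scaleNr scale1r opprK addrC.
apply: le_trans (norm_le_enorm _) _; rewrite enormZ normrN normfV.
rewrite ler_pdivrMl ?normr_gt0//; apply: le_trans (gC _) _.
rewrite addrK [h *: 1]mulr1 -(real_normK (num_real h)) expr2 mulrCA ler_pM2l ?normr_gt0//.
near: h; exists (e / (C + 1)); first by rewrite /= divr_gt0// ltr_wpDl.
move=> h /=; rewrite sub0r normrN => he _.
rewrite (@le_trans _ _ (C * (e / (C + 1))))//; first by rewrite ler_wpM2l// ltW.
by rewrite mulrCA ler_piMr ?ltW// ltr_pdivrMr ?ltr_wpDl// mul1r ltrDl.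
Unshelve. all: by end_near.
Qed.

(** * Thick curves *)

(** A single [r] serves all periodic maps at once, so that a curve, its derivative and a second
    curve can be moved to the same parameter. *)
Lemma periodic_representative (R : realType) (s t : R) :
  exists r, `|r - t| <= pi /\
    forall (T : Type) (f : R -> T), periodic2pi f -> f r = f s.
Proof.
have shift n x (T : Type) (f : R -> T) : periodic2pi f ->
    f (x + n%:R * (2 * pi)) = f x.
  move=> pf; elim: n => [|n IH]; first by rewrite mul0r addr0.
  by rewrite -natr1 mulrDl mul1r addrA pf.
pose k : int := Num.floor ((s - t + pi) / (2 * pi)).
have pi2 : 0 < 2 * pi :> R by rewrite mulr_gt0// pi_gt0.
exists (s - k%:~R * (2 * pi)); split.
  have := floor_itv ((s - t + pi) / (2 * pi)).
  rewrite -/k ler_pdivlMr// ltr_pdivrMr// intrD rmorph1 => /andP[k1 k2].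
  by rewrite ler_norml; lra.
move=> T f pf; case: k => n.
  by rewrite -[LHS](shift n _ _ _ pf) -pmulrn subrK.
by rewrite NegzE mulrNz mulNr opprK -pmulrn (shift _ _ _ _ pf).
Qed.

Lemma periodic_derive1 (R : realType) (g : R -> 'rV[R]_3) :
  periodic2pi g -> periodic2pi g^`()%classic.
Proof.
move=> pg t; rewrite /derive1.
have E : (fun h => h^-1 *: (g (h + (t + 2 * pi)) - g (t + 2 * pi))) =
    (fun h => h^-1 *: (g (h + t) - g t)).
  by apply/funext => h; rewrite addrA !pg.
by rewrite E.
Qed.

(* The condition, polynomial in the chord [w = g s - g t] and the velocity
   [v = dg t], that [g] stays outside of the open unit balls tangent to it at
   [g t]: the part of [w] normal to [v] is at most [|w|^2 / 2]. *)
Definition tangent_balls_empty (R : realType) (g dg : R -> 'rV[R]_3) :=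
  forall s t, let w := g s - g t in let v := dg t in
    4 * (dot v v * dot w w - dot w v ^+ 2) <= dot v v * dot w w ^+ 2.

Section thick_curves.
Context {R : realType}.
Variables (g dg : R -> 'rV[R]_3) (c C : R).
Hypothesis gdg : forall t, is_derive t (1:R) g (dg t).
Hypothesis c0 : 0 < c.
Hypothesis speed : forall t, enorm (dg t) = c.
Hypothesis dgC : forall s t, enorm (dg s - dg t) <= C * `|s - t|.
Hypothesis pg : periodic2pi g.
Hypothesis ballg : tangent_balls_empty g dg.

Let speed2 t : dot (dg t) (dg t) = c ^+ 2.
Proof. by rewrite -sqr_enorm speed. Qed.

Let chord_le s t : enorm (g s - g t) <= c * `|s - t|.
Proof. by apply: (enorm_chord gdg) => r; rewrite speed. Qed.

Let dot_speed s t : dot (dg s) (dg t) = c ^+ 2 - enorm (dg s - dg t) ^+ 2 / 2.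
Proof. by rewrite sqr_enorm !dotE !speed2 (dotC (dg t)); lra. Qed.

Let dot_chord s t : exists2 r, `|r - t| <= `|s - t| &
  dot (g s - g t) (dg t) = dot (dg r) (dg t) * (s - t).
Proof.
have [st|ts|->] := ltgtP s t.
- have [r [/andP[sr rt] E]] := dot_mvt gdg (dg t) st; exists r.
    by rewrite !ltr0_norm ?subr_lt0// lerN2 lerB// ltW.
  by rewrite !dotE; lra.
- have [r [/andP[sr rt] E]] := dot_mvt gdg (dg t) ts; exists r => //.
    by rewrite !gtr0_norm ?subr_gt0// lerB// ltW.
  by rewrite !dotE; lra.
- by exists t => //; rewrite !subrr -(scale0r 0) dotZl !mul0r mulr0.
Qed.

(** By [ballg] the normal part is at most half the squared chord, and the chord is at most [c] times
    the parameter distance. *)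
Lemma normal_chord s t w : w = g s - g t ->
  enorm (w - (dot w (dg t) / c ^+ 2) *: dg t) <= c ^+ 2 * (s - t) ^+ 2 / 2.
Proof.
move=> wE; have c2 : 0 < c ^+ 2 by rewrite exprn_gt0.
have ww : dot w w <= c ^+ 2 * (s - t) ^+ 2.
  rewrite -exprMn -sqr_enorm wE -(real_normK (num_real (c * _))).
  by rewrite ler_pXn2r// ?nnegrE ?enorm_ge0// normrM gtr0_norm// chord_le.
apply: (@le_trans _ _ (dot w w / 2)); last by rewrite ler_pM2r ?invr_gt0.
rewrite enorm_le_sqr; last by rewrite divr_ge0 ?dot_ge0.
rewrite -(ler_pM2l c2) -(ler_pM2l (ltr0Sn R 3)).
have := ballg s t; rewrite /= -wE !dotE (dotC (dg t) w) speed2.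
set x := dot w w; set y := dot w (dg t) => H.
rewrite [leLHS](_ : _ = 4 * (c ^+ 2 * x - y ^+ 2)); last by field; rewrite gt_eqF.
by apply: le_trans H _; lra.
Qed.

(** At short range the Taylor remainder splits into a normal part, bounded by [normal_chord], and a
    tangential part of higher order in [C]; the smallness assumption then removes [C] from the
    bound. *)
Let lipschitz_local s t : C ^+ 2 * `|s - t| <= c ^+ 3 ->
  enorm (dg s - dg t) <= 2 * c ^+ 2 * `|s - t|.
Proof.
have tay r u : C ^+ 2 * `|r - u| <= c ^+ 3 ->
    enorm (g r - g u - (r - u) *: dg u) <= c ^+ 2 * (r - u) ^+ 2.
  move=> small; have [w wE] : exists w, w = g r - g u by eexists.
  rewrite -wE.
  have -> : w - (r - u) *: dg u = (w - (dot w (dg u) / c ^+ 2) *: dg u) +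
      (dot w (dg u) / c ^+ 2 - (r - u)) *: dg u.
    by rewrite [in RHS]scalerBl addrA subrK.
  apply: le_trans (enormD _ _) _; rewrite enormZ speed.
  have [x xr] := dot_chord r u; rewrite -wE => E.
  (* The velocities have equal length, so their inner product differs from [c ^+ 2] only by half the
     square of [d]; one factor of [|r - u|] in that square absorbs [C ^+ 2]. *)
  have tang : `|dot w (dg u) / c ^+ 2 - (r - u)| * c <= c ^+ 2 * (r - u) ^+ 2 / 2.
    rewrite E dot_speed.
    set d := enorm _; rewrite (_ : _ - _ = - (d ^+ 2 / (2 * c ^+ 2) * (r - u))); last first.
      by field; rewrite gt_eqF.
    have d0 : 0 <= d by exact: enorm_ge0.
    have dC : d <= C * `|r - u|.
      apply: le_trans (dgC _ _) _; rewrite ler_wpM2l//.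
      have := dgC 1 0; rewrite subr0 normr1 mulr1; apply: le_trans; exact: enorm_ge0.
    have dd : d ^+ 2 <= C ^+ 2 * `|r - u| * `|r - u|.
      by rewrite -mulrA -expr2 -exprMn ler_pXn2r// nnegrE (le_trans d0).
    have dd2 : d ^+ 2 <= c ^+ 3 * `|r - u|.
      by apply: le_trans dd _; rewrite ler_wpM2r.
    rewrite normrN normrM ger0_norm; last by rewrite divr_ge0 ?sqr_ge0// mulr_ge0 ?sqr_ge0.
    rewrite -(real_normK (num_real (r - u))).
    rewrite [leLHS](_ : _ = d ^+ 2 * (`|r - u| / (2 * c))); last by field; rewrite gt_eqF.
    apply: (@le_trans _ _ (c ^+ 3 * `|r - u| * (`|r - u| / (2 * c)))).
      by rewrite ler_wpM2r// divr_ge0 ?mulr_ge0// ltW.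
    by rewrite le_eqVlt; apply/orP; left; apply/eqP; field; rewrite gt_eqF.
  by have := normal_chord wE; lra.
move=> small; have [->|st] := eqVneq s t; first by rewrite !subrr enorm0 normr0 mulr0.
have a0 : 0 < `|s - t| by rewrite normr_gt0 subr_eq0.
rewrite -(ler_pM2l a0) -enormZ.
(* The expansions at [t] and at [s] are added, so that the two chords cancel. *)
have -> : (s - t) *: (dg s - dg t) =
    (g s - g t - (s - t) *: dg t) + (g t - g s - (t - s) *: dg s).
  by apply/rowP => i; rewrite !mxE; ring.
apply: le_trans (enormD _ _) _.
have := tay _ _ small; rewrite distrC in small; have := tay _ _ small.
rewrite -(sqrrN (t - s)) opprB -(real_normK (num_real (s - t))) expr2.
by lra.
Qed.

(** Repeated bisection reduces any pair of parameters to short range. The bound depends on the speed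
    alone, which makes the velocities of thick curves of bounded length equicontinuous. *)
Lemma thick_lipschitz s t : enorm (dg s - dg t) <= 2 * c ^+ 2 * `|s - t|.
Proof.
have [d d0 loc] : exists2 d, 0 < d & forall r u, `|r - u| <= d ->
    enorm (dg r - dg u) <= 2 * c ^+ 2 * `|r - u|.
  exists (c ^+ 3 / (C ^+ 2 + 1)); first by rewrite divr_gt0 ?exprn_gt0// ltr_wpDl ?sqr_ge0.
  move=> r u ru; apply: lipschitz_local.
  apply: (@le_trans _ _ ((C ^+ 2 + 1) * `|r - u|)); first by rewrite ler_wpM2r ?lerDl.
  by rewrite mulrC -ler_pdivlMr// ltr_wpDl ?sqr_ge0.
have step n r u : `|r - u| <= 2 ^+ n * d ->
    enorm (dg r - dg u) <= 2 * c ^+ 2 * `|r - u|.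
  elim: n r u => [|n IH] r u; first by rewrite expr0 mul1r; exact: loc.
  rewrite exprS => ru; set x := (r + u) / 2.
  have rx : `|r - x| = `|r - u| / 2.
    by rewrite (_ : r - x = (r - u) / 2) ?normrM ?(@ger0_norm _ 2^-1)// /x; lra.
  have xu : `|x - u| = `|r - u| / 2.
    by rewrite (_ : x - u = (r - u) / 2) ?normrM ?(@ger0_norm _ 2^-1)// /x; lra.
  apply: le_trans (enorm_triangle (dg x) _ _) _.
  have := IH r x; have := IH x u; rewrite rx xu => H1 H2.
  by have := H1 ltac:(lra); have := H2 ltac:(lra); lra.
apply: (step (Num.bound (`|s - t| / d))); rewrite -ler_pdivrMr//.
by rewrite ltW// upper_nthrootP.
Qed.

(** As the curve closes up, some velocity is orthogonal to [dg 0]. The two differ by at least [c],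
    while [thick_lipschitz] over one period allows at most [4 * pi * c ^+ 2]. *)
Lemma thick_speed_ge : 1 <= 4 * pi * c.
Proof.
have pi0 := pi_gt0 R; have pi2 : (0 : R) < 2 * pi by rewrite mulr_gt0.
have [r [/andP[r0 r2] E]] := dot_mvt gdg (dg 0) pi2.
have := pg 0; rewrite add0r => g2; move: E; rewrite g2 subrr subr0 => /esym/eqP.
rewrite mulf_eq0 (gt_eqF pi2) orbF dot_speed => /eqP H.
have := thick_lipschitz r 0; rewrite subr0 gtr0_norm//.
have := enorm_ge0 (dg r - dg 0); set e := enorm _ in H * => e0 er.
have e4 : e <= 4 * pi * c * c by apply: le_trans er _; nra.
have : e ^+ 2 <= (4 * pi * c * c) ^+ 2 by rewrite ler_pXn2r// nnegrE (le_trans e0).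
rewrite exprMn => ee; have c2 : 0 < c ^+ 2 by rewrite exprn_gt0.
suff : 1 ^+ 2 <= (4 * pi * c) ^+ 2.
  by rewrite ler_pXn2r ?nnegrE ?mulr_ge0// ltW.
by rewrite -(ler_pM2r c2); lra.
Qed.

(** In this range the velocity changes by at most [c / 2], so its component along [dg t] stays above
    [7 / 8] of [c]. *)
Lemma near_chord s t : 4 * c * `|s - t| <= 1 ->
  c * `|s - t| <= 2 * enorm (g s - g t).
Proof.
move=> st; have [r rt E] := dot_chord s t.
have e0 := enorm_ge0 (dg r - dg t).
have er : enorm (dg r - dg t) <= c / 2.
  apply: le_trans (thick_lipschitz _ _) _.
  apply: (@le_trans _ _ (2 * c ^+ 2 * `|s - t|)); first by rewrite ler_wpM2l// mulr_ge0 ?sqr_ge0.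
  by rewrite expr2; have := ler_wpM2l (ltW c0) st; lra.
have ee : enorm (dg r - dg t) ^+ 2 <= (c / 2) ^+ 2.
  by rewrite ler_pXn2r// nnegrE divr_ge0// ltW.
have := norm_dot (g s - g t) (dg t); rewrite E dot_speed speed normrM.
rewrite ger0_norm; last by have := sqr_ge0 c; lra.
move=> H; rewrite -(ler_pM2r c0).
have := ler_wpM2r (normr_ge0 (s - t)) ee.
have := sqr_ge0 c; have := normr_ge0 (s - t) => n0 c2.
by have := mulr_ge0 c2 n0; lra.
Qed.

(* At an interior minimum of the distance to [g t] the chord is normal to the
   curve, so that by [ballg] it has length at least 2. *)
Lemma far_chord s t : injective_mod2pi g ->
  1 <= 4 * c * `|s - t| -> `|s - t| <= pi -> 1 <= 8 * enorm (g s - g t).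
Proof.
move=> ig; pose h := (4 * c)^-1.
have c4 : 0 < 4 * c by rewrite mulr_gt0.
have h0 : 0 < h by rewrite invr_gt0.
have ch : 4 * c * h = 1 by rewrite divff// gt_eqF.
have hpi : h <= pi by rewrite -(ler_pM2l c4) ch; have := thick_speed_ge; lra.
(* At the ends of the arc [near_chord] bounds the chord below by [c * h / 2], that is 1/8. *)
have near x y : `|x - y| = h -> 1 <= 8 * enorm (g x - g y).
  move=> xy; have := near_chord (s := x) (t := y); rewrite xy ch lexx => /(_ isT).
  lra.
pose f x := dot (g x - g t) (g x - g t).
have far x : t + h <= x <= t + 2 * pi - h -> 1 <= 8 * enorm (g x - g t).
  have [| |m mI minm] := @EVT_min R f (t + h) (t + 2 * pi - h).
  - by lra.
  - by apply: derivable_within_continuous => y _; case: (is_derive_sqdist gdg (g t) y).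
  move=> xI; have := minm x; rewrite in_itv xI => /(_ isT).
  rewrite -ler_enorm => mx; suff : 1 <= 8 * enorm (g m - g t) by lra.
  move: mI; rewrite in_itv/= => /andP[m1 m2].
  have [->|m1'] := eqVneq m (t + h); first by apply: near; rewrite addrAC subrr add0r gtr0_norm.
  have [->|m2'] := eqVneq m (t + 2 * pi - h).
    by rewrite addrAC pg; apply: near; rewrite addrAC subrr add0r normrN gtr0_norm.
  have mI : t + h < m < t + 2 * pi - h by rewrite !lt_neqAle m1 m2 m2' eq_sym m1'.
  have crit : dot (dg m) (g m - g t) = 0.
    apply: (dot_critical gdg mI) => y yI; apply: minm.
    by rewrite in_itv/=; case/andP: yI => /ltW -> /ltW ->.
  have [w wE] : exists w, w = g m - g t by eexists.
  have := ballg t m; rewrite /= -(opprB (g m)); rewrite -wE in crit *.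
  rewrite !(dotNl, dotNr) opprK (dotC w) crit oppr0 expr0n/= subr0 speed2 -sqr_enorm.
  have w1 : 0 < enorm w.
    rewrite enorm_gt0 wE subr_eq0; apply/eqP => /ig[k mk].
    have pi0 := pi_gt0 R.
    have k0 : 0 < k%:~R :> R by rewrite -(pmulr_lgt0 _ (_ : 0 < 2 * pi)); lra.
    have k1 : k%:~R < 1 :> R by rewrite -(ltr_pM2r (_ : 0 < 2 * pi)); lra.
    move: k0 k1; rewrite ltr0z (ltrz1 R k) => k0 k1.
    by have := lt_le_trans k1 k0; rewrite ltxx.
  rewrite mulrCA ler_pM2l ?exprn_gt0// [leRHS]expr2 ler_pM2r ?exprn_gt0// => w4.
  rewrite leNgt; apply/negP => w8.
  have : enorm w ^+ 2 < 1 ^+ 2 by rewrite ltr_pXn2r// ?nnegrE ?enorm_ge0//; lra.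
  by rewrite expr1n; lra.
rewrite -[X in X <= _]ch ler_pM2l// => hst spi; wlog ts : s hst spi / t <= s.
  move=> H; have [/H|st] := leP t s; first exact.
  rewrite -pg; apply: far.
  by move: hst spi; rewrite ltr0_norm ?subr_lt0//; lra.
apply: far; move: hst spi.
by rewrite ger0_norm ?subr_ge0//; lra.
Qed.

(** The constant is the same for all thick curves: it keeps limits injective and bounds the
    Lipschitz constant of a displacement between nearby curves. *)
Lemma chord_arc s t : injective_mod2pi g -> `|s - t| <= pi ->
  `|s - t| <= 8 * pi * enorm (g s - g t).
Proof.
move=> ig st; have [far|near] := leP 1 (4 * c * `|s - t|).
  have := far_chord ig far st => e1.
  by apply: le_trans st _; rewrite mulrAC ler_peMl ?pi_ge0.
have := near_chord (ltW near); rewrite -(ler_pM2l (_ : 0 < 4 * pi)); last first.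
  by rewrite mulr_gt0// pi_gt0.
have := ler_wpM2r (normr_ge0 (s - t)) thick_speed_ge; lra.
Qed.

End thick_curves.

(** * Reach *)

Section reach_of_curve.
Context {R : realType}.
Variables (g dg : R -> 'rV[R]_3) (c : R).
Hypothesis gdg : forall t, is_derive t (1:R) g (dg t).
Hypothesis c0 : 0 < c.
Hypothesis speed : forall t, enorm (dg t) = c.
Hypothesis pg : periodic2pi g.

Let speed2 t : dot (dg t) (dg t) = c ^+ 2.
Proof. by rewrite -sqr_enorm speed. Qed.

Lemma nearest_parameter x :
  exists t, forall s, enorm (x - g t) <= enorm (x - g s).
Proof.
have pi0 := pi_gt0 R.
have [| |m mI minm] := @EVT_min R (fun t => dot (g t - x) (g t - x)) (- pi) pi.
- lra.
- by apply: derivable_within_continuous => y _; case: (is_derive_sqdist gdg x y).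
exists m => s; have [r [rpi pr]] := periodic_representative s 0.
rewrite -(pr _ _ pg) !(enormC x) ler_enorm; apply: minm.
by rewrite in_itv/= -ler_norml -[r]subr0.
Qed.

Lemma nearest_normal x t : (forall s, enorm (x - g t) <= enorm (x - g s)) ->
  dot (x - g t) (dg t) = 0.
Proof.
move=> H; have tI : t - 1 < t < t + 1 by lra.
rewrite -opprB dotNl dotC (dot_critical gdg tI) ?oppr0// => s _.
by rewrite -ler_enorm !(enormC _ x).
Qed.

(** Pythagoras: the polynomial in [tangent_balls_empty] is the squared normal part of the chord,
    times the squared speed. *)
Lemma normal_component w t : dot (w - (dot w (dg t) / c ^+ 2) *: dg t) (dg t) = 0 /\
  c ^+ 2 * enorm (w - (dot w (dg t) / c ^+ 2) *: dg t) ^+ 2 =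
  c ^+ 2 * dot w w - dot w (dg t) ^+ 2.
Proof.
rewrite sqr_enorm; have cc : c != 0 by rewrite gt_eqF.
by rewrite !dotE (dotC (dg t) w) speed2; split; field.
Qed.

(** Let [g r] be as near to [x] as [g t]. Then [n = x - g t] is normal to the curve, and equal
    distances give [dot w w = 2 * dot n w]. Only the normal part [e] of [w] counts here, and
    [2 * enorm e <= dot w w], so [enorm n < 1] forces [w = 0]. *)
Lemma reach_ge1 : tangent_balls_empty g dg -> (1 <= reach (range g))%E.
Proof.
move=> ballg; apply: ereal_sup_ubound; exists 1 => //; split=> // x [_ [s _ <-] xs].
have [t mint] := nearest_parameter x.
exists (g t); split; first by split=> [|_ [r _ <-]]; [exists t|exact: mint].
move=> _ [[r _ <-] minr].
have [w wE] : exists w, w = g r - g t by eexists.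
have [n nE] : exists n, n = x - g t by eexists.
have n1 : enorm n < 1 by rewrite nE (le_lt_trans (mint s)).
have nrm : enorm (n - w) = enorm n.
  rewrite nE wE opprB addrA subrK; apply/eqP.
  by rewrite eq_le mint minr//; exists t.
have nw : dot w w = 2 * dot n w.
  by have := congr1 (fun z => z ^+ 2) nrm; rewrite !sqr_enorm !dotE (dotC w n); lra.
have nv := nearest_normal mint; rewrite -nE in nv.
have := ballg r t; rewrite /= -wE speed2; have [_ <-] := normal_component w t.
set e := _ - _ *: _.
have ne : dot n w = dot n e by rewrite /e dotBr dotZr nv mulr0 subr0.
rewrite mulrCA ler_pM2l ?exprn_gt0// => H.
have ew : 2 * enorm e <= dot w w.
  rewrite -(ler_pXn2r (n := 2))// ?nnegrE ?dot_ge0 ?mulr_ge0 ?enorm_ge0//.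
  by rewrite exprMn; lra.
have := dot_le n e; rewrite -ne => H1.
have H2 : dot w w <= enorm n * dot w w.
  rewrite [leLHS]nw; apply: le_trans (_ : _ <= enorm n * (2 * enorm e)) _; first lra.
  by rewrite ler_wpM2l ?enorm_ge0.
apply/esym/eqP; rewrite -subr_eq0 -wE -dot_eq0 eq_le dot_ge0 andbT leNgt.
by apply/negP => w0; move: H2; rewrite ler_pMl// leNgt n1.
Qed.

End reach_of_curve.

Lemma continuous_enorm (R : realType) : continuous (@enorm R).
Proof.
move=> x; apply/(@cvgrPdist_le _ _ _ (nbhs x) (nbhs_filter x)) => e e0.
near=> y; apply: (@le_trans _ _ (enorm (x - y))).
  rewrite ler_norml; have := enormD (x - y) y; have := enormD (y - x) x.
  by rewrite !subrK enormC; lra.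
apply: le_trans (enorm_le_norm _) _; rewrite -ler_pdivlMl//.
near: y; apply/(@nbhs_normP _ 'rV[R]_3); exists (2^-1 * e); first by rewrite /= mulr_gt0 ?invr_gt0.
by move=> y /ltW.
Unshelve. all: by end_near.
Qed.

Lemma compact_enorm_ball (R : realType) (x : 'rV[R]_3) r :
  compact [set y | enorm (y - x) <= r].
Proof.
apply: bounded_closed_compact.
  exists (r + `|x|); split; first exact: num_real.
  move=> M rM y /= yr; apply: le_trans (ltW rM); rewrite -lerBlDr.
  by apply: le_trans (lerB_dist _ _) _; apply: le_trans (norm_le_enorm _) _.
have -> : [set y | enorm (y - x) <= r] =
    (fun y => enorm (y - x)) @^-1` [set a | a <= r] by [].
apply: closed_comp; last exact: closed_le.
move=> y _; apply: continuous_comp; last exact: continuous_enorm.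
by apply: continuousB; [move=> A; exact|exact: cst_continuous].
Qed.

(** * Unique nearest points force the tangent balls to be empty *)

Section reach_gives_tangent_balls.
Context {R : realType}.
Variables (g dg : R -> 'rV[R]_3) (c C : R).
Hypothesis gdg : forall t, is_derive t (1:R) g (dg t).
Hypothesis c0 : 0 < c.
Hypothesis speed : forall t, enorm (dg t) = c.
Hypothesis dgC : forall s t, enorm (dg s - dg t) <= C * `|s - t|.
Hypothesis pg : periodic2pi g.
Hypothesis ig : injective_mod2pi g.
Hypothesis uniq_nearest : forall x s, enorm (x - g s) < 1 ->
  forall t r, (forall u, enorm (x - g t) <= enorm (x - g u)) ->
              (forall u, enorm (x - g r) <= enorm (x - g u)) -> g t = g r.

Let speed2 t : dot (dg t) (dg t) = c ^+ 2.
Proof. by rewrite -sqr_enorm speed. Qed.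

Let continuous_dist x : continuous (fun s => enorm (x - g s)).
Proof.
move=> s; apply: continuous_comp; last exact: continuous_enorm.
by apply: continuousB; [exact: cvg_cst|exact: (continuous_curve gdg)].
Qed.

Let periodic_min (f : R -> R) : continuous f -> periodic2pi f ->
  exists m, forall s, f m <= f s.
Proof.
move=> cf pf; have pi0 := pi_gt0 R.
have [| |m _ minm] := @EVT_min R f (- pi) pi; first lra.
  exact: continuous_subspaceT.
exists m => s; have [r [rpi pr]] := periodic_representative s 0.
by rewrite -(pr _ _ pf); apply: minm; rewrite in_itv/= -ler_norml -[r]subr0.
Qed.

(* First-order condition for a maximum of the distance to the curve over the
   ball of radius [rho] around [x]: otherwise moving [y] towards
   [x + (rho / |y - q|) (y - q)] would increase the distance. *)
Let max_distance x y r rho : 0 < rho -> enorm (y - x) <= rho ->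
  (forall s, enorm (y - g r) <= enorm (y - g s)) -> 0 < enorm (y - g r) < 1 ->
  (forall z, enorm (z - x) <= rho ->
     exists s, enorm (z - g s) <= enorm (y - g r)) ->
  y - x = (rho / enorm (y - g r)) *: (y - g r).
Proof.
move=> rho0 yx nr /andP[D0 D1] maxy.
have [w wE] : exists w, w = y - g r by eexists.
have [u uE] : exists u, u = y - x by eexists.
rewrite -wE -uE in nr D0 D1 maxy yx *.
set k := rho / enorm w; have k0 : 0 < k by rewrite divr_gt0.
have kw : k * enorm w = rho by rewrite divfK// gt_eqF.
apply/eqP; rewrite -subr_eq0; apply/negPn/negP => ne.
have [e eE] : exists e, e = k *: w - u by eexists.
have ew : 0 < dot e w.
  have : 0 < dot e e by rewrite dot_gt0 eE -opprB oppr_eq0.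
  have uu : dot u u <= rho ^+ 2 by rewrite -enorm_le_sqr// ltW.
  have ww : k ^+ 2 * dot w w = rho ^+ 2 by rewrite -sqr_enorm -exprMn kw.
  rewrite eE !dotE (dotC u w) => H; rewrite -(pmulr_rgt0 _ k0).
  by lra.
(* Where [psi] is positive, either moving along [e] increases the distance to [g s], or [g s] is
   already farther away than [g r]. Uniqueness of the nearest point makes the minimum positive. *)
pose psi s := Num.max (dot e (y - g s)) (enorm (y - g s) - enorm w).
have [m minm] : exists m, forall s, psi m <= psi s.
  apply: periodic_min; last by move=> s; rewrite /psi pg.
  move=> s; apply: (@continuous_max R R (fun s => dot e (y - g s))
    (fun s => enorm (y - g s) - enorm w) s).
    have -> : (fun s => dot e (y - g s)) = (fun s => dot e y - dot (g s) e).
      by apply/funext => z; rewrite dotBr (dotC e (g z)).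
    apply: continuousB; first exact: cvg_cst.
    apply/differentiable_continuous/derivable1_diffP.
    by case: (is_derive_dot gdg e s).
  apply: continuousB; last exact: cvg_cst.
  exact: continuous_dist.
have psi0 : 0 < psi m.
  rewrite lt_max subr_gt0; have [//|le0] := ltP 0 (dot e (y - g m)).
  rewrite orFb ltNge; apply/negP => le1; move: le0; apply/negP; rewrite -ltNge.
  have -> : g m = g r; last by rewrite -wE.
  apply: (@uniq_nearest y r); first by rewrite -wE.
    by move=> v; apply: le_trans le1 _; exact: nr.
  by rewrite -wE.
(* The bound 1 keeps the moved point in the ball by convexity; the other bound keeps points with
   excess distance [psi m] too far away after the move. *)
pose tau := Num.min 1 (psi m / (2 * enorm e)).
have e0 : 0 < enorm e.
  by rewrite enorm_gt0; apply/eqP => e0; move: ew; rewrite e0 dot0l ltxx.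
have tau0 : 0 < tau.
  by rewrite lt_min ltr01 divr_gt0// mulr_gt0.
have tau1 : tau <= 1 by rewrite ge_min lexx.
have taue : tau * enorm e < psi m.
  rewrite -ltr_pdivlMr// (@le_lt_trans _ _ (psi m / (2 * enorm e)))//.
    by rewrite ge_min lexx orbT.
  by rewrite invfM mulrCA gtr_pMl ?divr_gt0// invf_lt1// ltr1n.
have [|s] := maxy (y + tau *: e).
  have -> : y + tau *: e - x = (1 - tau) *: u + (tau * k) *: w.
    by rewrite eE uE; apply/rowP => i; rewrite !mxE; ring.
  apply: le_trans (enormD _ _) _; rewrite !enormZ ger0_norm ?subr_ge0//.
  rewrite (ger0_norm (mulr_ge0 (ltW tau0) (ltW k0))).
  rewrite -mulrA kw; have tau1' : 0 <= 1 - tau by rewrite subr_ge0.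
  have := ler_wpM2l tau1' yx; lra.
rewrite leNgt => /negP; apply.
have [z zE] : exists z, z = y - g s by eexists.
have -> : y + tau *: e - g s = z + tau *: e by rewrite zE addrAC.
have : psi m <= psi s by exact: minm.
rewrite {2}/psi -zE le_max => /orP[H|H].
  have wz : enorm w <= enorm z by rewrite zE.
  apply: le_lt_trans wz _; rewrite -ltr_sqr ?nnegrE ?enorm_ge0//.
  rewrite !sqr_enorm !(dotDl, dotDr, dotZl, dotZr) (dotC z e).
  by have := mulr_gt0 tau0 (lt_le_trans psi0 H); have := dot_ge0 (tau *: e); rewrite dotZl dotZr; lra.
have := enormD (z + tau *: e) (- (tau *: e)).
move: H taue; rewrite addrK enormN enormZ gtr0_norm//; lra.
Qed.

Let distance_max x rho : 0 <= rho -> exists y r,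
  [/\ enorm (y - x) <= rho, forall s, enorm (y - g r) <= enorm (y - g s)
    & forall z, enorm (z - x) <= rho ->
        exists s, enorm (z - g s) <= enorm (y - g r)].
Proof.
move=> rho0; have [N HN] := choice (nearest_parameter gdg pg).
pose f y := enorm (y - g (N y)).
have cf : continuous f.
  move=> y; apply/(@cvgrPdist_le _ _ _ (nbhs y) (nbhs_filter y)) => e e0.
  near=> z; apply: (@le_trans _ _ (enorm (y - z))).
    rewrite ler_norml /f; have := HN y (N z); have := HN z (N y).
    have := enorm_triangle z y (g (N z)); have := enorm_triangle y z (g (N y)).
    by rewrite (enormC z y); lra.
  apply: le_trans (enorm_le_norm _) _; rewrite -ler_pdivlMl//.
  near: z; apply/(@nbhs_normP _ 'rV[R]_3); exists (2^-1 * e).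
    by rewrite /= mulr_gt0 ?invr_gt0.
  by move=> z /ltW.
have [||y] := @EVT_max_rV R 3 f _ _ (@compact_enorm_ball R x rho).
- by exists x; rewrite /= subrr enorm0.
- exact: continuous_subspaceT.
rewrite inE /= => yx maxy; exists y, (N y); split=> // z zx.
by exists (N z); apply: maxy; rewrite inE.
Unshelve. all: by end_near.
Qed.

(** Take [y] at maximal distance [D] from the curve in the [rho]-ball about the centre [x]. By
    [max_distance], [x] lies between [y] and its nearest point [g r], at distance [D - rho] from
    [g r]. As the [d]-ball is empty, [D = d + rho]; uniqueness gives [g r = g t], so [y] is the
    centre of the larger ball. *)
Let extend_ball t n d rho : enorm n = 1 -> 0 < rho < d -> d + rho < 1 ->
  (forall s, d <= enorm (g t + d *: n - g s)) ->
  forall s, d + rho <= enorm (g t + (d + rho) *: n - g s).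
Proof.
move=> n1 /andP[rho0 rhod] drho Pd.
have d0 : 0 < d := lt_trans rho0 rhod.
have [x xE] : exists x, x = g t + d *: n by eexists.
rewrite -xE in Pd.
have xt : enorm (x - g t) = d by rewrite xE addrAC subrr add0r enormZ n1 mulr1 gtr0_norm.
have [y [r [yx nr maxy]]] := distance_max x (ltW rho0).
have Dd : d <= enorm (y - g r).
  by have [|s] := maxy x; [rewrite subrr enorm0 ltW|exact: le_trans].
have Dle : enorm (y - g r) <= d + rho.
  by apply: le_trans (nr t) _; have := enorm_triangle x y (g t); rewrite xt; lra.
have D01 : 0 < enorm (y - g r) < 1 by rewrite (lt_le_trans d0)//; lra.
have E := max_distance rho0 yx nr D01 maxy.
have [D DE] : exists D, D = enorm (y - g r) by eexists.
rewrite -DE in Dd Dle D01 E nr.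
have D0 : D != 0 by rewrite gt_eqF//; case/andP: D01.
have xr : x - g r = (1 - rho / D) *: (y - g r).
  by rewrite scalerBl scale1r -E; apply/rowP => i; rewrite !mxE; ring.
have xrn : enorm (x - g r) = D - rho.
  rewrite xr enormZ -DE ger0_norm ?subr_ge0 ?ler_pdivrMr ?mul1r; [|lra..].
  by rewrite mulrBl mul1r divfK.
have dD : D = d + rho by have := Pd r; rewrite xrn; lra.
have rt : g r = g t.
  apply: (@uniq_nearest x t); first by rewrite xt; lra.
    by move=> u; rewrite xrn dD addrK.
  by move=> u; rewrite xt.
have yE : y = g t + (d + rho) *: n.
  have : x - g t = d *: n by rewrite xE addrAC subrr add0r.
  rewrite -rt xr => H; rewrite -[y](subrK (g r)) addrC -dD; congr (_ + _).
  have kE : 1 - rho / D = d / D by rewrite -[X in X - _](divff D0) -mulrBl {1}dD addrK.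
  rewrite kE in H; apply: (@scalerI _ _ (d / D)).
    by rewrite mulf_neq0 ?invr_neq0// gt_eqF.
  by rewrite H scalerA divfK.
by move=> s; rewrite -yE -dD.
Qed.

(** Taylor's bound handles parameters near [t], and a positive minimal distance [mu] handles the
    rest of the period. The radius is independent of the normal [n]. *)
Let start_ball t : exists2 tau, 0 < tau & forall n, enorm n = 1 ->
  dot n (dg t) = 0 -> forall s, tau <= enorm (g t + tau *: n - g s).
Proof.
have C0 : 0 <= C.
  by have := dgC 1 0; rewrite subr0 normr1 mulr1; apply: le_trans; exact: enorm_ge0.
(* Up to [h] the Taylor error is at most half the linear term; [C + 1] avoids division by zero. *)
pose h := Num.min pi (c / (2 * (C + 1))).
have C1 : 0 < C + 1 by lra.
have h0 : 0 < h by rewrite lt_min pi_gt0 divr_gt0// mulr_gt0.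
have hpi : h <= pi by rewrite ge_min lexx.
have Ch : 2 * (C * h) <= c.
  have : h <= c / (2 * (C + 1)) by rewrite ge_min lexx orbT.
  by rewrite ler_pdivlMr ?mulr_gt0//; lra.
have near s : `|s - t| <= h -> c * `|s - t| <= 2 * enorm (g s - g t).
  move=> st; have := taylor1 gdg s t dgC; have := enormD (g s - g t - (s - t) *: dg t) (- (g s - g t)).
  rewrite addrAC subrr add0r !enormN enormZ speed -(real_normK (num_real (s - t))).
  have : 2 * (C * `|s - t| ^+ 2) <= c * `|s - t|.
    rewrite expr2 !mulrA ler_wpM2r// -mulrA (le_trans _ Ch)// ler_wpM2l// ler_wpM2l//.
  lra.
have [| |m mI minm] := @EVT_min R (fun s => enorm (g t - g s)) (t + h) (t + 2 * pi - h).
- lra.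
- by apply: continuous_subspaceT; exact: continuous_dist.
have [mu muE] : exists mu, mu = enorm (g t - g m) by eexists.
have mu0 : 0 < mu.
  rewrite muE enorm_gt0 subr_eq0; apply/eqP => /esym/ig[k mk].
  have pi0 := pi_gt0 R.
  move: mI; rewrite in_itv/= mk => /andP[k0 k1].
  have {}k0 : 0 < k%:~R :> R by rewrite -(pmulr_lgt0 _ (_ : 0 < 2 * pi)); lra.
  have {}k1 : k%:~R < 1 :> R by rewrite -(ltr_pM2r (_ : 0 < 2 * pi)); lra.
  move: k0 k1; rewrite ltr0z (ltrz1 R k) => k0 k1.
  by have := lt_le_trans k1 k0; rewrite ltxx.
rewrite -muE in minm.
have far s : h <= `|s - t| -> `|s - t| <= pi -> mu <= enorm (g s - g t).
  rewrite enormC => hst spi; have [ts|st] := leP t s.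
    apply: minm; rewrite in_itv/=; move: hst spi.
    by rewrite ger0_norm ?subr_ge0//; lra.
  rewrite -(pg s); apply: minm; rewrite in_itv/=; move: hst spi.
  by rewrite ltr0_norm ?subr_lt0//; lra.
(* The goal amounts to [2 * tau * dot n w <= dot w w] for chords [w]. Far away [2 * tau <= mu]
   suffices; nearby [dot n w] is at most [C] times the squared parameter distance and [dot w w] at
   least [c ^+ 2 / 4] times it. *)
exists (Num.min (mu / 2) (c ^+ 2 / (8 * (C + 1)))).
  by rewrite lt_min !divr_gt0 ?exprn_gt0// mulr_gt0.
set tau := Num.min _ _ => n n1 nt s.
have tau0 : 0 < tau by rewrite lt_min !divr_gt0 ?exprn_gt0// mulr_gt0.
have taumu : 2 * tau <= mu.
  have : tau <= mu / 2 by rewrite ge_min lexx.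
  lra.
have tauC : 8 * (tau * C) <= c ^+ 2.
  have : tau <= c ^+ 2 / (8 * (C + 1)) by rewrite ge_min lexx orbT.
  by rewrite ler_pdivlMr ?mulr_gt0//; lra.
have [r [rpi pr]] := periodic_representative s t; rewrite -(pr _ _ pg).
suff H : 2 * tau * dot n (g r - g t) <= dot (g r - g t) (g r - g t).
  rewrite -ler_sqr ?nnegrE ?enorm_ge0 ?(ltW tau0)// sqr_enorm.
  rewrite addrAC -(opprB (g r)).
  have nn : dot n n = 1 by rewrite -sqr_enorm n1 expr1n.
  rewrite !(dotDl, dotDr, dotNl, dotNr, dotZl, dotZr) nn.
  by move: H; rewrite !(dotDl, dotDr, dotNl, dotNr) (dotC (g t) n) (dotC (g r) n); lra.
rewrite -sqr_enorm; have [rh|rh] := leP `|r - t| h.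
  have := near _ rh; have := taylor1 gdg r t dgC.
  set e := enorm (_ - _ *: _) => eC H.
  have ne : dot n (g r - g t) <= e.
    have := dot_le n (g r - g t - (r - t) *: dg t).
    by rewrite n1 mul1r (dotBr n (g r - g t)) dotZr nt mulr0 subr0.
  have H2 : (c * `|r - t|) ^+ 2 <= (2 * enorm (g r - g t)) ^+ 2.
    by rewrite ler_sqr ?nnegrE// mulr_ge0 ?enorm_ge0// ltW.
  have H3 := ler_wpM2l (ltW tau0) (le_trans ne eC).
  have := ler_wpM2r (sqr_ge0 `|r - t|) tauC.
  move: H3 H2; rewrite -(real_normK (num_real (r - t))) !exprMn; lra.
have H1 := far _ (ltW rh) rpi.
have := dot_le n (g r - g t); rewrite n1 mul1r => H2.
rewrite expr2; apply: le_trans (_ : _ <= 2 * tau * enorm (g r - g t)) _.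
  by rewrite ler_wpM2l// mulr_ge0// ltW.
by rewrite ler_wpM2r ?enorm_ge0// (le_trans taumu).
Qed.

(** A small tangent ball is enlarged step by step to every radius below 1. If the condition failed
    for a chord, a ball of radius less than 1 in the direction of its normal part would contain the
    endpoint. *)
Lemma tangent_balls_empty_of_unique_nearest : tangent_balls_empty g dg.
Proof.
have ball t n tau : enorm n = 1 -> dot n (dg t) = 0 -> 0 < tau < 1 ->
    forall s, tau <= enorm (g t + tau *: n - g s).
  move=> n1 nt /andP[tau0 tau1].
  have [b b0 /(_ n n1 nt) H0] := start_ball t.
  have smaller a d : a <= d -> (forall s, d <= enorm (g t + d *: n - g s)) ->
      forall s, a <= enorm (g t + a *: n - g s).
    move=> ad Pd s; have := enormD (g t + a *: n - g s) ((d - a) *: n).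
    have -> : g t + a *: n - g s + (d - a) *: n = g t + d *: n - g s.
      by apply/rowP => i; rewrite !mxE; ring.
    rewrite enormZ n1 mulr1 ger0_norm ?subr_ge0//.
    by have := Pd s; lra.
  have step k a : 0 < a < 1 -> a <= b + k%:R * (b / 2) ->
      forall s, a <= enorm (g t + a *: n - g s).
    elim: k a => [|k IH] a /andP[a0 a1]; first by rewrite mul0r addr0 => /smaller; apply.
    rewrite -natr1 mulrDl mul1r => ak; have [|ak'] := leP a (b + k%:R * (b / 2)).
      by apply: IH; rewrite a0.
    have kb : 0 <= k%:R * (b / 2) by rewrite mulr_ge0// divr_ge0// ltW.
    (* Here [a > b], so the increment [b / 2] is smaller than the previous radius [a - b / 2], as
       [extend_ball] requires. *)
    rewrite -(subrK (b / 2) a); apply: extend_ball => //; [lra|lra|].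
    by apply: IH; lra.
  apply: (step (Num.bound (2 / b))); first by rewrite tau0.
  have b2 : 0 <= 2 / b by rewrite divr_ge0// ltW.
  by have := archi_boundP b2; rewrite ltr_pdivrMr//; lra.
move=> s t /=; have [w wE] : exists w, w = g s - g t by eexists.
rewrite -wE speed2; have [ev <-] := normal_component c0 speed w t.
have [e eE] : exists e, e = w - (dot w (dg t) / c ^+ 2) *: dg t by eexists.
rewrite -eE in ev *; rewrite mulrCA ler_pM2l ?exprn_gt0//.
suff : 2 * enorm e <= dot w w.
  move=> ew; suff : (2 * enorm e) ^+ 2 <= dot w w ^+ 2 by lra.
  by rewrite ler_sqr ?nnegrE ?mulr_ge0 ?enorm_ge0 ?dot_ge0.
have [->|e0] := eqVneq e 0; first by rewrite enorm0 mulr0 dot_ge0.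
have e1 : 0 < enorm e by rewrite enorm_gt0.
rewrite leNgt; apply/negP => we.
have q1 : dot w w / (2 * enorm e) < 1 by rewrite ltr_pdivrMr ?mulr_gt0// mul1r.
have q0 : 0 <= dot w w / (2 * enorm e) by rewrite divr_ge0 ?dot_ge0// mulr_ge0 ?enorm_ge0.
have [q qE] : exists q, q = dot w w / (2 * enorm e) by eexists.
have wq : dot w w = q * (2 * enorm e) by rewrite qE divfK// gt_eqF// mulr_gt0.
rewrite -qE in q0 q1.
(* [q] is the radius of the ball tangent at [g t] that passes through [g s]; any radius strictly
   between [q] and 1 gives the contradiction. *)
have [tau tauE] : exists tau, tau = (q + 1) / 2 by eexists.
have n1 : enorm ((enorm e)^-1 *: e) = 1.
  by rewrite enormZ ger0_norm ?invr_ge0 ?enorm_ge0// mulVf// gt_eqF.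
have nv : dot ((enorm e)^-1 *: e) (dg t) = 0 by rewrite dotZl ev mulr0.
have nw : dot ((enorm e)^-1 *: e) w = enorm e.
  have /(_ _ nv) -> : forall x, dot x (dg t) = 0 -> dot x w = dot x e.
    by move=> x xv; rewrite eE dotBr dotZr xv mulr0 subr0.
  by rewrite dotZl -sqr_enorm expr2 mulKf// gt_eqF.
move: (_ *: e) n1 nv nw => n n1 nv nw; have := ball t n tau n1 nv.
rewrite (_ : 0 < tau < 1); last by rewrite tauE; lra.
move=> /(_ isT s); rewrite addrAC -(opprB (g s)) -wE.
have t0 : 0 <= tau by rewrite tauE; lra.
rewrite -ler_sqr ?nnegrE ?enorm_ge0// sqr_enorm.
have nn : dot n n = 1 by rewrite -sqr_enorm n1 expr1n.
rewrite !(dotDl, dotDr, dotNl, dotNr, dotZl, dotZr) nn (dotC w n) nw wq => H.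
have : 0 < 2 * (tau - q) * (tau * enorm e).
  by rewrite !mulr_gt0// ?subr_gt0 tauE; lra.
have : 0 < (tau - q) * enorm e by rewrite mulr_gt0// subr_gt0 tauE; lra.
by lra.
Qed.

End reach_gives_tangent_balls.

(** * The estimates for the type [curve] *)

Section curve_facts.
Context {R : realType}.
Implicit Types g h : curve R.

Lemma curve_is_derive g t : is_derive t (1:R) g (g^`()%classic t).
Proof.
by have [_ _ dg _ _] := curveP g; rewrite derive1E; exact: DeriveDef.
Qed.

Lemma curve_periodic g : periodic2pi g.
Proof. by have [] := curveP g. Qed.

Lemma curve_injective g : injective_mod2pi g.
Proof. by have [] := curveP g. Qed.

Definition speed g : R := enorm (g^`()%classic 0).

Lemma curve_speed g t : enorm (g^`()%classic t) = speed g.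
Proof. by have [_ _ _ _ [c gc]] := curveP g; rewrite /speed !gc. Qed.

(** Zero speed would give [g pi = g 0], although [pi] is not a multiple of the period. *)
Lemma speed_gt0 g : 0 < speed g.
Proof.
rewrite lt_def enorm_ge0 andbT; apply/eqP => g0.
have pi0 := pi_gt0 R.
have := @enorm_chord R g _ (curve_is_derive g) 0 0 pi.
have g0' c : enorm (g^`()%classic c) <= 0 by rewrite curve_speed g0.
rewrite mul0r => /(_ g0') H.
have /eqP : enorm (g pi - g 0) = 0 by apply/eqP; rewrite eq_le H enorm_ge0.
rewrite enorm_eq0 subr_eq0 => /eqP/(@curve_injective g)[k pik].
have k0 : 0 < k%:~R :> R by rewrite -(pmulr_lgt0 _ (_ : 0 < 2 * pi)); lra.
have k1 : k%:~R < 1 :> R by rewrite -(ltr_pM2r (_ : 0 < 2 * pi)); lra.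
move: k0 k1; rewrite ltr0z (ltrz1 R k) => k0 k1.
by have := lt_le_trans k1 k0; rewrite ltxx.
Qed.

Lemma curve_lipschitz g : exists C, forall s t,
  enorm (g^`()%classic s - g^`()%classic t) <= C * `|s - t|.
Proof.
have [_ _ _ /pinfty_ex_gt0[M M0 gM] _] := curveP g.
exists (2 * M) => s t; apply: le_trans (enorm_le_norm _) _.
by rewrite -mulrA ler_wpM2l//; exact: (gM (s, t)).
Qed.

Lemma lengthE g : length g = 2 * pi * speed g.
Proof.
rewrite /length; under eq_Rintegral do rewrite curve_speed.
have pi2 : (0 : R) < 2 * pi by rewrite mulr_gt0// pi_gt0.
rewrite Rintegral_cst//; rewrite [X in fine X](lebesgue_measure_itv `[0, 2 * pi])/= lte_fin pi2.
by rewrite -EFinB/= subr0 mulrC.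
Qed.

Definition thick g := tangent_balls_empty g g^`()%classic.

Lemma thickness_ge1 g : (1 <= thickness g)%E <-> thick g.
Proof.
have [C gC] := curve_lipschitz g; split=> [g1|]; last first.
  exact: reach_ge1 (curve_is_derive g) (speed_gt0 g) (@curve_speed g) (@curve_periodic g).
apply: (tangent_balls_empty_of_unique_nearest (curve_is_derive g) (speed_gt0 g)
  (@curve_speed g) gC (@curve_periodic g) (@curve_injective g)).
move=> x s xs t r nt nr.
(* The supremum may be 1 without being attained; the strict inequality still gives an admissible
   radius [q] beyond the distance of [x] from [g s]. *)
have /ereal_sup_gt[_ [q [_ Hq] <-]] : ((enorm (x - g s))%:E < thickness g)%E.
  by apply: lt_le_trans g1; rewrite lte_fin.
rewrite lte_fin => sq; have [|a [_ ua]] := Hq x; first by exists (g s) => //; exists s.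
by transitivity a; [apply/esym|]; apply: ua; split=> [|_ [u _ <-]//]; [exists t|exists r].
Qed.

Lemma thick_curve_lipschitz g s t : thick g ->
  enorm (g^`()%classic s - g^`()%classic t) <= 2 * speed g ^+ 2 * `|s - t|.
Proof.
move=> tg; have [C gC] := curve_lipschitz g.
exact: thick_lipschitz (curve_is_derive g) (speed_gt0 g) (@curve_speed g) gC tg _ _.
Qed.

Lemma thick_curve_chord_arc g s t : thick g -> `|s - t| <= pi ->
  `|s - t| <= 8 * pi * enorm (g s - g t).
Proof.
move=> tg; have [C gC] := curve_lipschitz g.
exact: chord_arc (curve_is_derive g) (speed_gt0 g) (@curve_speed g) gC
  (@curve_periodic g) tg _ _ (@curve_injective g).
Qed.

End curve_facts.

(** * Ambient isotopies *)

(** Makes [banach_fixed_point] applicable to maps of ['rV[R]_3]. *)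
HB.instance Definition _ (R : realType) :=
  Uniform_isComplete.Build 'rV[R]_3 cauchy_cvg.

Section ambient_isotopies.
Context {R : realType}.
Implicit Types A B C : set 'rV[R]_3.

(** The isotopies are composed at equal times instead of run one after the other, so no gluing in
    time occurs. *)
Lemma ambient_isotopic_trans A B C :
  ambient_isotopic A B -> ambient_isotopic B C -> ambient_isotopic A C.
Proof.
move=> [H1 [c1 h1 s1 e1]] [H2 [c2 h2 s2 e2]].
exists (fun p => H2 (p.1, H1 p)); split.
- apply/subspace_continuousP => p Ap.
  pose phi (z : R * 'rV[R]_3) := (z.1, H1 z).
  have cphi : phi @ within (`[0, 1] `*` setT) (nbhs p) --> phi p.
    have cf : fst @ within (`[0, 1] `*` setT) (nbhs p) --> p.1.
      by apply: (cvg_within_filter (f := fst)); exact: cvg_fst.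
    have cs : H1 @ within (`[0, 1] `*` setT) (nbhs p) --> H1 p.
      exact: (subspace_continuousP _ _).1 c1 p Ap.
    exact: cvg_pair cf cs.
  move=> U HU.
  have Aphi : (`[0, 1] `*` setT) (phi p) by case: Ap.
  have K := cphi _ ((subspace_continuousP _ _).1 c2 _ Aphi U HU).
  apply: (@filterS _ (nbhs p) (nbhs_filter p) _ _ _ K) => z Hz Az.
  by apply: Hz => //; case: Az.
- move=> s s01; have [cf1 [g1 [cg1 fg1 gf1]]] := h1 _ s01.
  have [cf2 [g2 [cg2 fg2 gf2]]] := h2 _ s01; split.
    by move=> x; exact: (@continuous_comp _ _ _ _ _ x (cf1 x) (cf2 _)).
  exists (g1 \o g2); split=> [x|x|x] /=.
  + exact: (@continuous_comp _ _ _ _ _ x (cg2 x) (cg1 _)).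
  + by rewrite fg2 fg1.
  + by rewrite gf1 gf2.
- by move=> x /=; rewrite s1 s2.
- by rewrite -e2 -e1 image_comp.
Qed.

Lemma klipschitz_continuous (f : 'rV[R]_3 -> 'rV[R]_3) k : 0 <= k ->
  (forall x y, `|f x - f y| <= k * `|x - y|) -> continuous f.
Proof.
move=> k0 fk x; apply/(@cvgrPdist_le _ _ _ (nbhs x) (nbhs_filter x)) => e e0.
near=> y; apply: le_trans (fk _ _) _.
apply: (@le_trans _ _ ((k + 1) * `|x - y|)); first by rewrite ler_wpM2r// lerDl.
rewrite -ler_pdivlMl ?ltr_wpDl//.
near: y; apply/(@nbhs_normP _ 'rV[R]_3); exists ((k + 1)^-1 * e).
  by rewrite /= mulr_gt0 ?invr_gt0 ?ltr_wpDl.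
by move=> y /ltW.
Unshelve. all: by end_near.
Qed.

(** A preimage of [y] is a fixed point of the contraction sending [x] to [y - v x]; the lower bound
    [expand] gives injectivity and a Lipschitz inverse. *)
Lemma homeomorphism_perturbation (v : 'rV[R]_3 -> 'rV[R]_3) k :
  0 <= k < 1 -> (forall x y, `|v x - v y| <= k * `|x - y|) ->
  homeomorphism (fun x => x + v x).
Proof.
move=> /andP[k0 k1] vk.
have fixpoint y : exists x, x + v x = y.
  pose f := fun x => y - v x.
  have [|||x _ xE] := @banach_fixed_point R _ (@setT 'rV[R]_3) (totalfun f).
  - exists (NngNum k0); split => //= -[a b] _ /=.
    rewrite (_ : _ - _ = v b - v a) 1?distrC ?vk//.
    by apply/rowP => i; rewrite !mxE; ring.
  - exact: closedT.
  - by exists 0.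
  by exists x; rewrite {1}xE subrK.
have [g gE] := choice fixpoint.
have expand x y : (1 - k) * `|x - y| <= `|(x + v x) - (y + v y)|.
  have := vk x y; have := ler_normB ((x + v x) - (y + v y)) (v x - v y).
  have -> : x + v x - (y + v y) - (v x - v y) = x - y.
    by apply/rowP => i; rewrite !mxE; ring.
  lra.
have k1' : 0 < 1 - k by rewrite subr_gt0.
split.
  apply: (@klipschitz_continuous _ (1 + k)); first by rewrite addr_ge0.
  move=> x y; rewrite opprD addrACA; apply: le_trans (ler_normD _ _) _.
  by have := vk x y; lra.
exists g; split; last exact: gE.
  apply: (@klipschitz_continuous _ (1 - k)^-1); first by rewrite invr_ge0 ltW.
  by move=> x y; rewrite ler_pdivlMl//; have := expand (g x) (g y); rewrite !gE.
move=> x; apply/eqP; rewrite -subr_eq0 -normr_eq0 eq_le normr_ge0 andbT.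
by rewrite -(ler_pM2l k1') mulr0 (le_trans (expand _ _))// gE subrr normr0.
Qed.

Lemma ambient_isotopic_perturbation A (v : 'rV[R]_3 -> 'rV[R]_3) k :
  0 <= k < 1 -> (forall x y, `|v x - v y| <= k * `|x - y|) ->
  ambient_isotopic A [set x + v x | x in A].
Proof.
move=> k01 vk; have /andP[k0 k1] := k01.
have cv := klipschitz_continuous k0 vk.
exists (fun p => p.2 + p.1 *: v p.2); split.
- apply: continuous_subspaceT => -[s x]; apply: cvgD; first exact: cvg_snd.
  apply: cvgZ; first exact: cvg_fst.
  apply: (@cvg_comp _ _ _ snd v _ (nbhs x)); first exact: cvg_snd.
  exact: cv.
- move=> s /andP[s0 s1]; apply: (homeomorphism_perturbation k01) => x y /=.
  rewrite -scalerBr normrZ ger0_norm//; apply: le_trans (vk x y).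
  by rewrite ler_piMl.
- by move=> x /=; rewrite scale0r addr0.
- by apply: eq_imagel => x _ /=; rewrite scale1r.
Qed.

(* McShane's extension: the infimum over [t] of [w t + k * `|x - p t|]. *)
Lemma lipschitz_extension (T : Type) (t0 : T) (p : T -> 'rV[R]_3) (w : T -> R) k :
  0 <= k -> (forall s t, `|w s - w t| <= k * `|p s - p t|) ->
  exists2 u : 'rV[R]_3 -> R, forall t, u (p t) = w t &
    forall x y, `|u x - u y| <= k * `|x - y|.
Proof.
move=> k0 wk; pose V x := range (fun t => w t + k * `|x - p t|).
have lbV x t : lbound (V x) (w t - k * `|x - p t|).
  move=> _ [s _ <-]; have := wk t s; rewrite ler_norml => /andP[_].
  have := ler_wpM2l k0 (ler_distD x (p t) (p s)); rewrite (distrC (p t) x); lra.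
have hi x : has_inf (V x).
  by split; [exists (w t0 + k * `|x - p t0|); exists t0|exists (w t0 - k * `|x - p t0|); exact: lbV].
have infle x t : inf (V x) <= w t + k * `|x - p t|.
  by apply: ge_inf; [case: (hi x)|exists t].
exists (fun x => inf (V x)) => [t|].
  apply/eqP; rewrite eq_le; apply/andP; split.
    by have := infle (p t) t; rewrite subrr normr0 mulr0 addr0.
  apply: lb_le_inf; first by case: (hi (p t)).
  by have := @lbV (p t) t; rewrite subrr normr0 mulr0 subr0.
have le1 x y : inf (V x) <= inf (V y) + k * `|x - y|.
  rewrite -lerBlDr; apply: lb_le_inf; first by case: (hi y).
  move=> _ [t _ <-]; have := infle x t.
  by have := ler_wpM2l k0 (ler_distD y x (p t)); lra.
by move=> x y; rewrite ler_norml; have := le1 x y; have := le1 y x; rewrite (distrC y); lra.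
Qed.

End ambient_isotopies.

(** * The C^1 topology on curves *)

Section c1_topology.
Context {R : realType}.
Implicit Types (g h k : curve R) (e : R).

(** Measured in Euclidean norms, so that congruences act by isometries. *)
Definition c1_close e g h := forall t, enorm (h t - g t) <= e /\
  enorm (h^`()%classic t - g^`()%classic t) <= e.

Lemma c1_close_sym e g h : c1_close e g h -> c1_close e h g.
Proof. by move=> gh t; have [a b] := gh t; split; rewrite enormC. Qed.

Lemma c1_close_trans d e g h k :
  c1_close d g h -> c1_close e h k -> c1_close (d + e) g k.
Proof.
move=> gh hk t; have [a1 a2] := gh t; have [b1 b2] := hk t; split.
  by apply: le_trans (enorm_triangle (h t) _ _) _; rewrite addrC lerD.
by apply: le_trans (enorm_triangle (h^`()%classic t) _ _) _; rewrite addrC lerD.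
Qed.

Lemma c1_close_le d e g h : d <= e -> c1_close d g h -> c1_close e g h.
Proof. by move=> de gh t; have [a b] := gh t; split; exact: le_trans de. Qed.

Lemma nbhs_uniform (f : {uniform R -> 'rV[R]_3}) P :
  nbhs f P <->
  exists2 e, 0 < e & forall u : R -> 'rV[R]_3, (forall t, `|f t - u t| < e) -> P u.
Proof.
split=> [/uniform_nbhs[E [entE EP]]|[e e0 eP]].
  move: entE; rewrite -entourage_ballE => -[e /= e0 eE]; exists e => // u fu.
  by apply: EP => t _; apply: eE => /=; rewrite -ball_normE /=; exact: fu.
apply/uniform_nbhs; exists [set xy | ball xy.1 e xy.2]; split.
  by rewrite -entourage_ballE; exists e.
move=> u fu; apply: eP => t; have := fu t I.
  by rewrite /= -ball_normE.
Qed.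

Lemma nbhs_curve g P :
  nbhs g P <-> exists2 e, 0 < e & forall h, c1_close e g h -> P h.
Proof.
split=> [|[e e0 eP]].
  rewrite nbhsE => -[B [[A oA <-] Ag] BP].
  have [[A1 A2] /= [/nbhs_uniform[a a0 aA] /nbhs_uniform[b b0 bA]] A12] :
    nbhs (jet g) A by exact: open_nbhs_nbhs.
  exists (Num.min a b / 2); first by rewrite divr_gt0// lt_min a0.
  move=> h gh; apply: BP; apply: A12; split=> /=; [apply: aA|apply: bA] => t.
    have [+ _] := gh t => H; apply: le_lt_trans (norm_le_enorm _) _.
    rewrite enormC; apply: le_lt_trans H _.
    by rewrite ltr_pdivrMr// gt_min; apply/orP; left; lra.
  have [_ +] := gh t => H; apply: le_lt_trans (norm_le_enorm _) _.
  rewrite enormC; apply: le_lt_trans H _.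
  by rewrite ltr_pdivrMr// gt_min; apply/orP; right; lra.
have e2 : 0 < e / 2 by rewrite divr_gt0.
have : nbhs (jet g) ([set f | forall t, `|g t - f t| < e / 2] `*`
    [set f | forall t, `|g^`()%classic t - f t| < e / 2]).
  exists ([set f | forall t, `|g t - f t| < e / 2],
    [set f | forall t, `|g^`()%classic t - f t| < e / 2]) => //.
  by split; apply/nbhs_uniform; exists (e / 2).
move=> /(@initial_continuous _ _ (@jet R)).
apply: (@filterS _ (nbhs g) (nbhs_filter g)) => h [/= h1 h2]; apply: eP => t.
have small v : `|v| < e / 2 -> enorm v <= e.
  by move=> ve; apply: le_trans (enorm_le_norm _) _; lra.
by split; rewrite enormC; apply: small.
Qed.

(** By the chord-arc bound the displacement [h t - g t] is a Lipschitz function of the point [g t].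
    Its extension [v] to all of space has Lipschitz constant at most 1/2, and adding [v] carries one
    image onto the other. *)
Lemma c1_close_isotopic e g h : thick g -> 0 <= e -> 32 * pi * e <= 1 ->
  c1_close e g h -> ambient_isotopic (range g) (range h).
Proof.
move=> tg e0 epi gh; pose d t := h t - g t.
have dd t : is_derive t (1:R) d (h^`()%classic t - g^`()%classic t).
  exact: is_deriveB (curve_is_derive h t) (curve_is_derive g t).
have pi0 := pi_gt0 R.
(* The factor [8 * pi] comes from the chord-arc bound, the remaining 2 from the passage to the sup
   norm. *)
pose q := 16 * pi * e.
have q0 : 0 <= q by rewrite !mulr_ge0// ltW.
have dq s t i : `|d s 0 i - d t 0 i| <= q * `|g s - g t|.
  have coord (v : 'rV[R]_3) : `|v 0 i| <= `|v|.
    by rewrite [leRHS]/Num.Def.normr/= mx_normrE (le_bigmax _ (fun ij => `|v ij.1 ij.2|) (0, i)).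
  rewrite (_ : d s 0 i - d t 0 i = (d s - d t) 0 i); last by rewrite !mxE.
  apply: le_trans (coord _) _; apply: le_trans (norm_le_enorm _) _.
  have [r [rpi pr]] := periodic_representative s t.
  have -> : d s = d r by rewrite /d (pr _ _ (@curve_periodic _ g)) (pr _ _ (@curve_periodic _ h)).
  rewrite -(pr _ _ (@curve_periodic _ g)).
  apply: le_trans (enorm_chord dd _ _ (fun c => (gh c).2)) _.
  apply: le_trans (ler_wpM2l e0 (thick_curve_chord_arc tg rpi)) _.
  have := ler_wpM2l (mulr_ge0 (mulr_ge0 (ler0n R 8) (ltW pi0)) e0) (enorm_le_norm (g r - g t)).
  by rewrite /q; lra.
have ext i : exists u : 'rV[R]_3 -> R, (forall t, u (g t) = d t 0 i) /\
    (forall x y, `|u x - u y| <= q * `|x - y|).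
  by have [u u1 u2] := lipschitz_extension 0 q0 (fun s t => dq s t i); exists u.
have [u uP] := choice ext.
(* For the sup norm, extending each coordinate separately keeps the Lipschitz constant [q]. *)
pose v x : 'rV[R]_3 := \row_i u i x.
have vq x y : `|v x - v y| <= q * `|x - y|.
  rewrite [leLHS]/Num.Def.normr/= mx_normrE; apply/bigmax_leP => /=.
  by split=> [|[i j] _ /=]; [exact: mulr_ge0|rewrite !mxE; exact: (uP j).2].
have <- : [set x + v x | x in range g] = range h.
  have vg t : g t + v (g t) = h t.
    by apply/rowP => i; rewrite !mxE (uP i).1 /d !mxE addrC subrK.
  apply/seteqP; split=> [_ [_ [t _ <-] <-]|_ [t _ <-]]; first by exists t.
  by exists (g t) => //; exists t.
apply: (ambient_isotopic_perturbation _ _ vq).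
by rewrite q0 /q/=; lra.
Qed.

End c1_topology.

(** * Congruences as isometries of the C^1 distance *)

Section congruence.
Context {R : realType}.
Implicit Types (f g h k : curve R) (Q : 'M[R]_3) (b : 'rV[R]_3) (a s e : R).

Lemma is_derive_motion f Q b a s t : Q *m Q^T = 1%:M -> s = 1 \/ s = -1 ->
  is_derive t (1:R) (fun u => f (s * u + a) *m Q + b)
    (s *: (f^`()%classic (s * t + a) *m Q)).
Proof.
move=> QQ s1; have [C fC] := curve_lipschitz f.
have ss : s ^+ 2 = 1 by case: s1 => ->; rewrite ?sqrrN expr1n.
apply: (@is_derive_taylor _ _ _ _ C) => u.
have -> : f (s * u + a) *m Q + b - (f (s * t + a) *m Q + b) -
    (u - t) *: (s *: (f^`()%classic (s * t + a) *m Q)) =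
    (f (s * u + a) - f (s * t + a) -
     (s * u + a - (s * t + a)) *: f^`()%classic (s * t + a)) *m Q.
  rewrite !mulmxBl -scalemxAl scalerA opprD addrACA subrr addr0; congr (_ - _ *: _).
  by ring.
rewrite enorm_mulmx//; apply: le_trans (taylor1 (curve_is_derive f) _ _ fC) _.
rewrite (_ : s * u + a - (s * t + a) = s * (u - t)); last by ring.
by rewrite exprMn ss mul1r.
Qed.

Lemma congruent_derive1 f h Q b a s : Q *m Q^T = 1%:M -> s = 1 \/ s = -1 ->
  (forall t, h t = f (s * t + a) *m Q + b) ->
  forall t, h^`()%classic t = s *: (f^`()%classic (s * t + a) *m Q).
Proof.
move=> QQ s1 hE t; rewrite derive1E.
have -> : (h : R -> 'rV[R]_3) = (fun u => f (s * u + a) *m Q + b) by exact/funext.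
by have [_ ->] := is_derive_motion f b a t QQ s1.
Qed.

Lemma motion_curve f Q b a s : Q *m Q^T = 1%:M -> s = 1 \/ s = -1 ->
  exists h : curve R, forall t, h t = f (s * t + a) *m Q + b.
Proof.
move=> QQ s1; pose F t := f (s * t + a) *m Q + b.
have ns : `|s| = 1 by case: s1 => ->; rewrite ?normrN normr1.
have dF t : F^`()%classic t = s *: (f^`()%classic (s * t + a) *m Q).
  by rewrite derive1E; have [_ ->] := is_derive_motion f b a t QQ s1.
have CF : C11_embedding F.
  split.
  - move=> t; rewrite /F; congr (_ *m _ + _).
    have pf := @curve_periodic _ f.
    by case: s1 => ->; [rewrite -[RHS]pf|rewrite -[LHS]pf]; congr (f _); ring.
  - move=> u v /addIr/(congr1 (mulmx^~ Q^T)); rewrite -!mulmxA QQ !mulmx1.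
    move=> /(@curve_injective _ f)[k E].
    case: s1 E => -> E; [exists k|exists (- k); rewrite rmorphN/=]; lra.
  - by move=> t; have [] := is_derive_motion f b a t QQ s1.
  - have [C fC] := curve_lipschitz f.
    exists C; split; first exact: num_real.
    move=> M CM -[u v] _ /=; rewrite !dF -scalerBr normrZ ns mul1r.
    apply: le_trans (norm_le_enorm _) _; rewrite -mulmxBl enorm_mulmx//.
    apply: le_trans (fC _ _) _.
    rewrite (_ : s * u + a - (s * v + a) = s * (u - v)); last by ring.
    by rewrite normrM ns mul1r ler_wpM2r// ltW.
  - exists (speed f) => t; rewrite dF enormZ ns mul1r (enorm_mulmx _ QQ).
    exact: curve_speed.
by exists (Curve CF).
Qed.

(** The motion that takes [f] to [h] is applied to [g]. *)
Lemma congruent_c1_close e f g h : congruent f h -> c1_close e f g ->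
  exists2 k, congruent g k & c1_close e h k.
Proof.
move=> [Q [b [a [s [QQ dQ s1 hE]]]]] fg.
have [k kE] := motion_curve g b a QQ s1.
exists k; first by exists Q, b, a, s.
have ns : `|s| = 1 by case: s1 => ->; rewrite ?normrN normr1.
move=> t; rewrite (congruent_derive1 QQ s1 kE) (congruent_derive1 QQ s1 hE) kE hE.
rewrite opprD addrACA subrr addr0 -mulmxBl -scalerBr -mulmxBl enormZ ns mul1r.
by rewrite !(enorm_mulmx _ QQ).
Qed.

Lemma congruent_speed f h : congruent f h -> speed h = speed f.
Proof.
move=> [Q [b [a [s [QQ dQ s1 hE]]]]].
have ns : `|s| = 1 by case: s1 => ->; rewrite ?normrN normr1.
rewrite {1}/speed (congruent_derive1 QQ s1 hE) enormZ ns mul1r (enorm_mulmx _ QQ).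
exact: curve_speed.
Qed.

Lemma congruent_thick f h : congruent f h -> thick f -> thick h.
Proof.
move=> [Q [b [a [s [QQ dQ s1 hE]]]]] tf u v /=.
have ss : s * s = 1 by case: s1 => ->; rewrite ?mulrNN mulr1.
rewrite (congruent_derive1 QQ s1 hE) !hE opprD addrACA subrr addr0 -mulmxBl.
rewrite !(dotZl, dotZr) !dot_mulmx// exprMn expr2 !mulrA ss !mul1r -!mulrA.
exact: tf.
Qed.

Lemma congruent_origin f : exists2 h, congruent f h & h 0 = 0.
Proof.
have QQ : 1%:M *m (1%:M)^T = 1%:M :> 'M[R]_3 by rewrite trmx1 mulmx1.
have s1 : 1 = 1 :> R \/ 1 = -1 :> R by left.
have [h hE] := motion_curve f (- f 0) 0 QQ s1.
exists h; first by exists 1%:M, (- f 0), 0, 1; split => //; exact: det1.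
by rewrite hE mulr0 addr0 mulmx1 subrr.
Qed.

End congruence.

(** A cluster point of an ultrafilter is a limit; this provides the pointwise limits of curves and
    velocities. *)
Lemma ultra_cvg_compact (T : Type) (U : topologicalType)
    (F : set_system T) (f : T -> U) (K : set U) :
  UltraFilter F -> compact K -> F (f @^-1` K) -> exists p : U, f @ F --> p.
Proof.
move=> FU cK FK; have FF : ProperFilter F by exact: ultra_proper.
have [p [_ clp]] := cK (f @ F) _ FK.
exists p => N Np; have [//|FN] := in_ultra_setVsetC (f @^-1` N) FU.
by have [q [nNq Nq]] := clp (~` N) N FN Np.
Qed.

(** * Limits of Euclidean expressions *)

Section euclidean_limits.
Context {R : realType} {T : topologicalType} {F : set_system T} {FF : ProperFilter F}.
Implicit Types (u v : T -> 'rV[R]_3) (x y : 'rV[R]_3).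

Lemma cvg_dot u v x y : u @ F --> x -> v @ F --> y ->
  (fun z => dot (u z) (v z)) @ F --> dot x y.
Proof.
move=> ux vy; have coord (w : T -> 'rV[R]_3) (z : 'rV[R]_3) i : w @ F --> z -> (fun t => w t 0 i) @ F --> z 0 i.
  by move=> wz; apply: (@cvg_comp _ _ _ w (fun y : 'rV[R]_3 => y 0 i) _ _ _ wz);
    exact: coord_continuous.
rewrite /dot !big_ord_recl !big_ord0.
under eq_fun do rewrite !big_ord_recl !big_ord0.
by repeat apply: cvgD; [apply: cvgM; exact: coord..|exact: cvg_cst].
Qed.

Lemma cvg_enorm u x : u @ F --> x -> (fun z => enorm (u z)) @ F --> enorm x.
Proof. by move=> ux; apply: (@cvg_comp _ _ _ u (@enorm R) _ _ _ ux); exact: continuous_enorm. Qed.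

Lemma tangent_balls_empty_limit (G D : T -> R -> 'rV[R]_3) (g dg : R -> 'rV[R]_3) :
  (forall t, (fun z => G z t) @ F --> g t) ->
  (forall t, (fun z => D z t) @ F --> dg t) ->
  F [set z | tangent_balls_empty (G z) (D z)] -> tangent_balls_empty g dg.
Proof.
move=> Gg Dg ball s t /=; have cV := Dg t.
have cW : (fun z => G z s - G z t) @ F --> g s - g t by exact: cvgB.
have cWW := cvg_dot cW cW; have cVV := cvg_dot cV cV; have cWV := cvg_dot cW cV.
rewrite expr2 [in leRHS]expr2.
set x := (X in X <= _); set y := (X in _ <= X).
have L1 : (fun z => 4 * (dot (D z t) (D z t) * dot (G z s - G z t) (G z s - G z t) -
    dot (G z s - G z t) (D z t) * dot (G z s - G z t) (D z t))) @ F --> x.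
  apply: cvgM; first exact: cvg_cst.
  apply: cvgB; first by apply: cvgM; [exact: cVV|exact: cWW].
  by apply: cvgM; exact: cWV.
have L2 : (fun z => dot (D z t) (D z t) *
    (dot (G z s - G z t) (G z s - G z t) * dot (G z s - G z t) (G z s - G z t))) @ F --> y.
  by apply: cvgM; [exact: cVV|apply: cvgM; exact: cWW].
have sub : F [set z | 4 * (dot (D z t) (D z t) * dot (G z s - G z t) (G z s - G z t) -
    dot (G z s - G z t) (D z t) * dot (G z s - G z t) (D z t)) <= dot (D z t) (D z t) *
    (dot (G z s - G z t) (G z s - G z t) * dot (G z s - G z t) (G z s - G z t))].
  by apply: filterS ball => z /(_ s t); rewrite /= !expr2.
exact: ler_cvg_to L1 L2 sub.
Qed.

End euclidean_limits.

Lemma nbhs_enorm_ball (R : realType) (x : 'rV[R]_3) e : 0 < e ->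
  nbhs x [set y | enorm (y - x) <= e].
Proof.
move=> e0; apply/(@nbhs_normP _ 'rV[R]_3); exists (e / 2); first by rewrite /= divr_gt0.
move=> y /= xy; apply: le_trans (enorm_le_norm _) _.
by rewrite distrC; lra.
Qed.

(** * Compactness of thick curves of bounded length *)

Section compactness.
Context {R : realType}.

(** The base point [g 0 = 0] removes translations, which would otherwise destroy compactness. *)
Definition thick_curves (M : R) : set (curve R) :=
  [set g | [/\ thick g, speed g <= M & g 0 = 0]].

Lemma thick_curves_derive1 M (g : curve R) s t : thick_curves M g ->
  enorm (g^`()%classic s - g^`()%classic t) <= 2 * M ^+ 2 * `|s - t|.
Proof.
move=> [tg gM _]; apply: le_trans (thick_curve_lipschitz _ _ tg) _.
rewrite ler_wpM2r// ler_wpM2l// ler_sqr ?nnegrE ?(ltW (speed_gt0 g))//.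
exact: le_trans (ltW (speed_gt0 g)) gM.
Qed.

Lemma thick_curves_chord M (g : curve R) s t : thick_curves M g ->
  enorm (g s - g t) <= M * `|s - t|.
Proof.
move=> [_ gM _]; apply: (enorm_chord (curve_is_derive g)) => c.
by rewrite curve_speed.
Qed.

(* Two curves of [thick_curves M] that are close at the points of a finite grid
   are close everywhere, by equicontinuity. *)
Lemma c1_close_grid M e : 0 < M -> 0 < e -> exists (N : nat) (grid : 'I_N -> R),
  forall g h : curve R, thick_curves M g -> thick_curves M h ->
    (forall i, enorm (h (grid i) - g (grid i)) <= e / 3) ->
    (forall i, enorm (h^`()%classic (grid i) - g^`()%classic (grid i)) <= e / 3) ->
  c1_close e g h.
Proof.
(* [L] dominates the Lipschitz constants of the curves and of their velocities; at mesh [d] each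
   passage to the grid costs [e / 3]. *)
move=> M0 e0; pose L := M + 2 * M ^+ 2.
have M2 : 0 < M ^+ 2 by rewrite exprn_gt0.
have L0 : 0 < L by rewrite /L; lra.
pose d := e / (3 * L); have d0 : 0 < d by rewrite divr_gt0// mulr_gt0.
have Ld : L * d = e / 3 by rewrite /d; field; rewrite gt_eqF.
have pi0 := pi_gt0 R.
pose N := (Num.truncn (2 * pi / d)).+1.
exists N, (fun i : 'I_N => i%:R * d) => g h Sg Sh gh dgh.
have [gp hp] := (@curve_periodic _ g, @curve_periodic _ h).
move=> t; have [r [rpi pr]] := periodic_representative t pi.
rewrite -(pr _ _ gp) -(pr _ _ hp) -(pr _ _ (periodic_derive1 gp)) -(pr _ _ (periodic_derive1 hp)).
have {rpi} /andP[r0 r2] : 0 <= r <= 2 * pi by move: rpi; rewrite ler_norml; lra.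
have rd : 0 <= r / d by rewrite divr_ge0// ltW.
have iN : (Num.truncn (r / d) < N)%N.
  by rewrite ltnS; apply: le_truncn; rewrite ler_pM2r ?invr_gt0.
have := gh (Ordinal iN); have := dgh (Ordinal iN) => /=.
have [x xE] : exists x, x = (Num.truncn (r / d))%:R * d by eexists.
rewrite -xE => dghx ghx.
have rx : `|r - x| <= d.
  have := truncn_itv rd; rewrite ler_pdivlMr// ltr_pdivrMr// -xE -natr1 mulrDl mul1r -xE.
  by move=> /andP[x1 x2]; rewrite ger0_norm ?subr_ge0//; lra.
have xr : `|x - r| <= d by rewrite distrC.
have near (f : R -> 'rV[R]_3) k : 0 <= k <= L -> (forall s t, enorm (f s - f t) <= k * `|s - t|) ->
    enorm (f r - f x) <= e / 3.
  move=> /andP[k0 kL] fk; apply: le_trans (fk _ _) _; rewrite -Ld.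
  by apply: ler_pM.
have three (f1 f2 : R -> 'rV[R]_3) : enorm (f1 r - f1 x) <= e / 3 ->
    enorm (f2 r - f2 x) <= e / 3 -> enorm (f2 x - f1 x) <= e / 3 ->
    enorm (f2 r - f1 r) <= e.
  move=> H1 H2 H3; have := enorm_triangle (f2 x) (f2 r) (f1 r).
  by have := enorm_triangle (f1 x) (f2 x) (f1 r); rewrite (enormC (f1 x)); lra.
have kM : 0 <= M <= L by rewrite /L; lra.
have kM2 : 0 <= 2 * M ^+ 2 <= L by rewrite /L; lra.
have G1 := near g M kM (fun u v => thick_curves_chord u v Sg).
have H1 := near h M kM (fun u v => thick_curves_chord u v Sh).
have G2 := near g^`()%classic _ kM2 (fun u v => thick_curves_derive1 u v Sg).
have H2 := near h^`()%classic _ kM2 (fun u v => thick_curves_derive1 u v Sh).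
by split; [exact: three g h G1 H1 ghx|exact: three g^`()%classic h^`()%classic G2 H2 dghx].
Qed.

(** Arzela-Ascoli along an ultrafilter: curves and velocities converge pointwise, the uniform
    estimates make the limit a thick curve, and a finite grid turns pointwise into C^1
    convergence. *)
Lemma compact_thick_curves M : compact (thick_curves M).
Proof.
rewrite compact_ultra => F FU FS; have FF : ProperFilter F by exact: ultra_proper.
have [g0 Sg0] := filter_ex FS.
have M0 : 0 < M by case: Sg0 => _ /(lt_le_trans (speed_gt0 g0)).
have limG t : exists y : 'rV[R]_3, (fun g : curve R => g t) @ F --> y.
  apply: ultra_cvg_compact FU (@compact_enorm_ball R 0 (M * `|t|)) _.
  apply: filterS FS => g Sg /=; have [_ _ <-] := Sg.
  by rewrite -[X in _ * `|X|]subr0; exact: thick_curves_chord Sg.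
have limD t : exists y : 'rV[R]_3, (fun g : curve R => g^`()%classic t) @ F --> y.
  apply: ultra_cvg_compact FU (@compact_enorm_ball R 0 M) _.
  by apply: filterS FS => g [_ gM _] /=; rewrite subr0 curve_speed.
have [[G HG] [D HD]] := (choice limG, choice limD).
have lim_le (a b : curve R -> R) x y : a @ F --> x -> b @ F --> y ->
    (forall g, thick_curves M g -> a g <= b g) -> x <= y.
  by move=> ax bY ab; apply: (ler_cvg_to ax bY); exact: filterS FS.
have cst (x : R) : (fun _ : curve R => x) @ F --> x by exact: cvg_cst.
have DM s t : enorm (D s - D t) <= 2 * M ^+ 2 * `|s - t|.
  apply: lim_le (cvg_enorm (cvgB (HD s) (HD t))) (cst _) _ => g Sg.
  exact: thick_curves_derive1 Sg.
have GD t : is_derive t (1:R) G (D t).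
  apply: (@is_derive_taylor _ _ _ _ (2 * M ^+ 2)) => s.
  apply: lim_le (cvg_enorm (cvgB (cvgB (HG s) (HG t)) (cvgZl_tmp (HD t)))) (cst _) _ => g Sg.
  apply: (taylor1 (curve_is_derive g)) => u v; exact: thick_curves_derive1 Sg.
have Dspeed t : enorm (D t) = enorm (D 0).
  apply/eqP; rewrite eq_le; apply/andP; split;
    apply: lim_le (cvg_enorm (HD _)) (cvg_enorm (HD _)) _ => g Sg;
    by rewrite !curve_speed.
have Gball : tangent_balls_empty G D.
  apply: (tangent_balls_empty_limit (G := fun g : curve R => g : R -> 'rV[R]_3)
    (D := fun g : curve R => g^`()%classic) HG HD).
  by apply: filterS FS => g [].
have Gper : periodic2pi G.
  move=> t; have H := HG (t + 2 * pi).
  have E : (fun g : curve R => g (t + 2 * pi)) = (fun g => g t).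
    by apply/funext => g; rewrite curve_periodic.
  rewrite E in H; exact: cvg_unique H (HG t).
(* A pointwise limit of injective curves need not be injective; the uniform chord-arc bound passes
   to the limit and excludes this. *)
have Gchord s t : `|s - t| <= pi -> `|s - t| <= 8 * pi * enorm (G s - G t).
  move=> st; apply: lim_le (cst _) (cvgM (cst (8 * pi)) (cvg_enorm (cvgB (HG s) (HG t)))) _.
  by move=> g [tg _ _]; exact: thick_curve_chord_arc.
have G0 : G 0 = 0.
  apply/eqP; rewrite -enorm_eq0 eq_le enorm_ge0 andbT.
  by apply: lim_le (cvg_enorm (HG 0)) (cst 0) _ => g [_ _ ->]; rewrite enorm0.
have DE : G^`()%classic = D by apply/funext => t; rewrite derive1E; case: (GD t).
have CG : C11_embedding G.
  split=> //.
  - move=> s t Gst; have [r [rpi pr]] := periodic_representative s t.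
    have := Gchord _ _ rpi; rewrite (pr _ _ Gper) Gst subrr enorm0 mulr0.
    rewrite normr_le0 subr_eq0 => /eqP rt.
    (* As [r = t], the periodic [g0] takes equal values at [s] and [t]; its injectivity supplies the
       integer. *)
    by apply: (@curve_injective _ g0); rewrite -(pr _ _ (@curve_periodic _ g0)) rt.
  - exists (2 * M ^+ 2); split; first exact: num_real.
    move=> C MC -[s t] _ /=; rewrite DE; apply: le_trans (norm_le_enorm _) _.
    by apply: le_trans (DM _ _) _; rewrite ler_wpM2r// ltW.
  - by exists (enorm (D 0)) => t; rewrite DE.
pose p := Curve CG.
have Sp : thick_curves M p.
  split=> //; first by rewrite /thick DE.
  rewrite /speed DE; apply: lim_le (cvg_enorm (HD 0)) (cst M) _ => g [_ gM _].
  by rewrite curve_speed.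
exists p; split=> // N /nbhs_curve[e e0 eN].
have [n [grid close]] := c1_close_grid M0 e0.
have e3 : 0 < e / 3 by rewrite divr_gt0.
have FG : F [set g : curve R | forall i : 'I_n, enorm (g (grid i) - G (grid i)) <= e / 3].
  apply: (@filter_forall _ 'I_n (fun i => [set g : curve R |
    enorm (g (grid i) - G (grid i)) <= e / 3])) => i.
  exact: (HG (grid i) _ (nbhs_enorm_ball _ e3)).
have FD : F [set g : curve R | forall i : 'I_n,
    enorm (g^`()%classic (grid i) - D (grid i)) <= e / 3].
  apply: (@filter_forall _ 'I_n (fun i => [set g : curve R |
    enorm (g^`()%classic (grid i) - D (grid i)) <= e / 3])) => i.
  exact: (HD (grid i) _ (nbhs_enorm_ball _ e3)).
apply: (@filterS _ F _ _ N _ (filterI FS (filterI FG FD))) => g [Sg [gG gD]]; apply: eN; apply: close => // i.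
by rewrite /= DE; exact: gD.
Qed.

End compactness.

(** * The moduli space *)

Section moduli_space.
Local Open Scope quotient_scope.
Context {R : realType}.
Implicit Types (g h k u v : curve R) (e : R) (A B : set (@moduli R)).

Lemma pi_moduliP g h : \pi_moduli g = \pi_moduli h <-> congruent g h.
Proof.
split=> [gh|gh].
  by apply/asboolP; apply/(@eqmodP _ (@congruentb_equiv R)); exact: gh.
by apply/(@eqmodP _ (@congruentb_equiv R)); exact/asboolP.
Qed.

Lemma pi_moduli_surj (x : @moduli R) : exists g, x = \pi_moduli g.
Proof. by exists (repr x); rewrite reprK. Qed.

Lemma pi_moduli_continuous : continuous (fun g => \pi_moduli g : @moduli R).
Proof. exact: pi_continuous. Qed.

Lemma open_moduli A : open A <-> forall g, A (\pi_moduli g) ->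
  exists2 e, 0 < e & forall h, c1_close e g h -> A (\pi_moduli h).
Proof.
have -> : open A = open ((fun g => \pi_moduli g) @^-1` A) by [].
rewrite openE; split=> [oA g /oA/nbhs_curve//|H g Ag].
by apply/nbhs_curve; exact: H.
Qed.

Lemma closed_moduli A : closed A <-> forall g,
  (forall e, 0 < e -> exists2 h, c1_close e g h & A (\pi_moduli h)) ->
  A (\pi_moduli g).
Proof.
rewrite -openC open_moduli; split=> [H g gA|H g nA].
  apply: contrapT => /H[e e0 eA]; have [h gh Ah] := gA e e0.
  exact: eA gh Ah.
apply: contrapT => H2; apply: nA; apply: H => e e0.
apply: contrapT => H3; apply: H2; exists e => // h gh Ah.
by apply: H3; exists h.
Qed.

(* The curves nearer to [A] than to [B]: congruences are isometries for the C^1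
   distance, so that this set is saturated. *)
Let nearer A B : set (curve R) := [set g | exists d e, [/\ d < e,
  exists2 u, A (\pi_moduli u) & c1_close d u g
  & forall v, B (\pi_moduli v) -> ~ c1_close e v g]].

Let nearer_congruent A B g h : congruent g h -> nearer A B g -> nearer A B h.
Proof.
move=> gh [d [e [de [u Au ug] nB]]]; exists d, e; split; [exact: de| |move=> v Bv vh].
  have [k uk hk] := congruent_c1_close gh (c1_close_sym ug).
  by exists k; [rewrite -(pi_moduliP u k).2|exact: c1_close_sym].
have [k vk gk] := congruent_c1_close (congruent_sym gh) (c1_close_sym vh).
apply: (nB k); first by rewrite -(pi_moduliP v k).2.
exact: c1_close_sym.
Qed.

Let open_nearer A B : open [set x | exists2 g, nearer A B g & x = \pi_moduli g].
Proof.
apply/open_moduli => g [g' Ng' /esym/pi_moduliP g'g].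
have [d [e [de [u Au ug] nB]]] := nearer_congruent g'g Ng'.
(* A third of the gap may be lost on each side and [d < e] still holds. *)
have r0 : 0 < (e - d) / 3 by rewrite divr_gt0// subr_gt0.
exists ((e - d) / 3); first exact: r0.
move=> h gh; exists h; last by [].
exists (d + (e - d) / 3), (e - (e - d) / 3); split; first lra.
  by exists u; [exact: Au|exact: c1_close_trans ug gh].
move=> v Bv vh; apply: (nB v Bv).
by have := c1_close_trans vh (c1_close_sym gh); rewrite subrK.
Qed.

Let sub_nearer A B : closed B -> A `&` B = set0 ->
  A `<=` [set x | exists2 g, nearer A B g & x = \pi_moduli g].
Proof.
move=> cB AB0 x Ax; have [g xg] := pi_moduli_surj x; exists g; last exact: xg.
have nBg : ~ B (\pi_moduli g).
  by move=> Bg; have : set0 x by rewrite -AB0; split; [|rewrite xg].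
have [e e0 eB] := (open_moduli (~` B)).1 (closed_openC cB) g nBg.
exists 0, e; split; first exact: e0.
  exists g; first by rewrite -xg.
  by move=> t; rewrite !subrr enorm0.
by move=> v Bv vg; exact: eB v (c1_close_sym vg) Bv.
Qed.

(** A class on both sides would give [d < e] and [d' < e']. If [d' < e], then [v] is too close;
    otherwise [d < e'], and [u] is. *)
Lemma normal_moduli : normal_space (@moduli R).
Proof.
apply/(@normal_openP R) => A B cA cB AB0.
exists [set x | exists2 g, nearer A B g & x = \pi_moduli g],
  [set x | exists2 g, nearer B A g & x = \pi_moduli g]; split.
- exact: open_nearer.
- exact: open_nearer.
- exact: sub_nearer.
- by apply: sub_nearer => //; rewrite setIC.
rewrite -subset0 => x [[g Ng xg] [h Nh xh]].
have hg : congruent h g by apply/pi_moduliP; rewrite -xg -xh.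
have [d [e [de [u Au ug] nB]]] := Ng.
have [d' [e' [de' [v Bv vg] nA]]] := nearer_congruent hg Nh.
have [dd'|d'd] := leP e d'; last first.
  by apply: (nB v Bv); exact: c1_close_le (ltW d'd) vg.
apply: (nA u Au); apply: c1_close_le ug.
by apply: ltW; apply: lt_trans de _; exact: le_lt_trans dd' de'.
Qed.

End moduli_space.

(** * Closedness of the thickness and speed bounds *)

Section closed_conditions.
Context {R : realType}.
Implicit Types (g h k : curve R) (e : R).

Lemma thick_closed g :
  (forall e, 0 < e -> exists2 h, c1_close e g h & thick h) -> thick g.
Proof.
move=> H; pose T := [set h : curve R | thick h].
have FF : ProperFilter (within T (nbhs g)).
  apply: within_nbhs_proper => N /nbhs_curve[e e0 eN].
  by have [h gh th] := H e e0; exists h; split=> //; exact: eN.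
have close (a : curve R -> 'rV[R]_3) :
    (forall e h, 0 < e -> c1_close e g h -> enorm (a h - a g) <= e) ->
    a @ within T (nbhs g) --> a g.
  move=> aP; apply/(@cvgrPdist_le _ _ _ (within T (nbhs g)) _) => e e0.
  apply/nbhs_curve; exists e => // h gh _.
  by rewrite distrC (le_trans (norm_le_enorm _))//; exact: aP.
apply: (@tangent_balls_empty_limit R (curve R) (within T (nbhs g)) FF
  (fun h => h : R -> 'rV[R]_3) (fun h => h^`()%classic)).
- by move=> t; apply: (close (fun h => h t)) => e h _ /(_ t)[].
- by move=> t; apply: (close (fun h => h^`()%classic t)) => e h _ /(_ t)[].
- by apply/nbhs_curve; exists 1.
Qed.

Lemma speed_closed g M :
  (forall e, 0 < e -> exists2 h, c1_close e g h & speed h <= M) -> speed g <= M.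
Proof.
move=> H; apply/ler_addgt0Pr => e e0; have [h gh hM] := H e e0.
have [_] := gh 0; have := enorm_triangle (h^`()%classic 0) (g^`()%classic 0) 0.
by rewrite !subr0 (enormC (g^`()%classic 0) (h^`()%classic 0)) !curve_speed; lra.
Qed.

End closed_conditions.

(** * The spaces [Y K L] are closed, compact and nested *)

Section configuration_spaces.
Local Open Scope quotient_scope.
Context {R : realType} (K : set (set 'rV[R]_3)).
Hypothesis hK : knot_type K.
Implicit Types (g h k : curve R) (L : R) (x : @moduli R).

Lemma Y_repr L x : Y K L x <-> exists h,
  [/\ K (range h), thick h, 2 * pi * speed h <= L & x = \pi_moduli h].
Proof.
split=> [[h [Kh th hL] <-]|[h [Kh th hL ->]]]; exists h.
  by split; [exact: Kh|exact/thickness_ge1|rewrite -lengthE|].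
  by split; [exact: Kh|exact/thickness_ge1|rewrite lengthE].
by [].
Qed.

Lemma knot_type_isotopic A B : ambient_isotopic A B -> K A -> K B.
Proof. by have [C [_ ->]] := hK => AB CA; exact: ambient_isotopic_trans AB. Qed.

(** Thickness and length bounds pass to the limit; the knot type is read off from one sufficiently
    close representative. *)
Lemma closed_Y L : closed (Y K L).
Proof.
have pi0 := pi_gt0 R; have pi2 : 0 < 2 * pi :> R by rewrite mulr_gt0.
apply/closed_moduli => g gY.
have approx e : 0 < e -> exists h k, [/\ c1_close e g h, congruent h k,
    K (range k), thick k & 2 * pi * speed k <= L].
  move=> e0; have [h gh /Y_repr[k [Kk tk kL hk]]] := gY e e0.
  by exists h, k; split; [exact: gh|exact/pi_moduliP|exact: Kk|exact: tk|exact: kL].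
have tg : thick g.
  apply: thick_closed => e /approx[h [k [gh hk _ tk _]]].
  by exists h; [exact: gh|exact: congruent_thick (congruent_sym hk) tk].
have gL : 2 * pi * speed g <= L.
  rewrite -ler_pdivlMl//; apply: speed_closed => e /approx[h [k [gh hk _ _ kL]]].
  by exists h; [exact: gh|rewrite -(congruent_speed hk) ler_pdivlMl].
(* The largest distance that [c1_close_isotopic] admits. *)
have e0 : 0 < (32 * pi)^-1 :> R by rewrite invr_gt0 mulr_gt0.
have [h [k [gh hk Kk tk _]]] := approx _ e0.
(* The limit curve is moved next to [k], the curve known to be thick and of type [K]. *)
have [g' gg' kg'] := congruent_c1_close hk (c1_close_sym gh).
apply/Y_repr; exists g'; split.
- apply: knot_type_isotopic Kk; apply: c1_close_isotopic tk (ltW e0) _ kg'.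
  by rewrite divff// gt_eqF// mulr_gt0.
- exact: congruent_thick gg' tg.
- by rewrite (congruent_speed gg').
- exact/pi_moduliP.
Qed.

(** Every class has a representative through the origin, so this is a closed subset of a continuous
    image of [thick_curves]. *)
Lemma compact_Y L : compact (Y K L).
Proof.
have pi2 : 0 < 2 * pi :> R by rewrite mulr_gt0// pi_gt0.
have cI : compact ((fun g => \pi_moduli g : @moduli R) @` thick_curves (L / (2 * pi))).
  apply: continuous_compact; last exact: compact_thick_curves.
  by apply: continuous_subspaceT; exact: pi_moduli_continuous.
apply: (@subclosed_compact _ (Y K L) _ _ cI); first exact: closed_Y.
move=> x /Y_repr[h [_ th hL ->]]; have [k hk k0] := congruent_origin h.
exists k; last by apply/esym/pi_moduliP.
split; [exact: congruent_thick hk th| |exact: k0].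
by rewrite (congruent_speed hk) ler_pdivlMr// mulrC.
Qed.

Lemma subset_Y L L' : L <= L' -> Y K L `<=` Y K L'.
Proof.
move=> LL x /Y_repr[h [Kh th hL ->]]; apply/Y_repr; exists h.
by split; [exact: Kh|exact: th|exact: le_trans LL|].
Qed.

(** The representatives may vary with [e], but congruent curves have equal speed, so one of them
    satisfies all the bounds. *)
Lemma bigcap_Y L : Y K L = \bigcap_(e in [set e : R | 0 < e]) Y K (L + e).
Proof.
apply/seteqP; split=> [x Yx e /= e0|x Yx].
  by apply: subset_Y Yx; rewrite lerDl ltW.
have /Y_repr[h [Kh th _ xh]] := Yx 1 ltr01.
apply/Y_repr; exists h; split; [exact: Kh|exact: th| |exact: xh].
apply/ler_addgt0Pr => e e0; have /Y_repr[k [_ _ kL xk]] := Yx e e0.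
suff kh : congruent k h by rewrite (congruent_speed kh).
by apply/pi_moduliP; rewrite -xk.
Qed.

End configuration_spaces.

Theorem corollary6p8 (R : realType) (K : set (set 'rV[R]_3)) (hK : knot_type K)
    (Lambda : R) (hLambda : (min_ropelength K <= Lambda%:E)%E) :
  (forall x y : moduli, Y K Lambda x -> Y K Lambda y ->
     (forall e : R, 0 < e ->
        connected_component (Y K (Lambda + e)) x =
        connected_component (Y K (Lambda + e)) y) ->
     connected_component (Y K Lambda) x = connected_component (Y K Lambda) y)
  /\
  (let A := Y K Lambda in
   let B := fun e : {posnum R} => Y K (Lambda + e%:num) in
   set_fun (Conn A) (Conn_lim A B) (Conn_to_lim B) /\
   set_inj (Conn A) (Conn_to_lim B)).
Proof.
have components x y : Y K Lambda x -> Y K Lambda y ->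
    (forall e : R, 0 < e ->
       connected_component (Y K (Lambda + e)) x =
       connected_component (Y K (Lambda + e)) y) ->
    connected_component (Y K Lambda) x = connected_component (Y K Lambda) y.
  apply: (connected_component_bigcap (Z := fun e : R => Y K (Lambda + e))).
  - exact: normal_moduli.
  - by move=> e _; exact: closed_Y.
  - by move=> e _; exact: compact_Y.
  - by move=> d e de; apply: subset_Y; rewrite lerD2l.
  - exact: bigcap_Y.
split; first exact: components.
move=> A B; have subAB e : A `<=` B e by apply: subset_Y; rewrite lerDl.
have subBB (d e : {posnum R}) : d%:num <= e%:num -> B d `<=` B e.
  by move=> de; apply: subset_Y; rewrite lerD2l.
split; first exact: set_fun_Conn_to_lim.
(* Equality in the inverse limit, read at each positive [e], is the hypothesis of [components]. *)
apply: set_inj_Conn_to_lim => // x y Ax Ay xy.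
by apply: components => // e e0; exact: (xy (PosNum e0)).
Qed.
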